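(* Let $f(z)=a_{d_1}z^{d_1}+\cdots+a_0$ be a non-constant complex polynomial of degree $d_1\ge 1$ (so $a_{d_1}\neq 0$). For each $c\in\mathbb{C}$, the function $g_c:\mathbb{C}\to\mathbb{R}_+$ given by $g_c(z)=\lim_{n\to+\infty}\frac{1}{d_n}\log_+|f_n(z)|$ satisfies the following properties: (1) $g_c$ is harmonic in $\mathbb{C}\setminus\mathcal{K}_c$; (2) $\mathcal{K}_c=g_c^{-1}(\{0\})$; (3) $g_c(z)-\log|z|$ tends to the constant $(\log|a_{d_1}|)\sum_{n=0}^{+\infty}\frac{(-1)^n}{d_nd_{n+1}}$ as $|z|\to+\infty$; (4) the map $(c,z)\mapsto g_c(z)$ is continuous on $\mathbb{C}\times\mathbb{C}$.
   Context: For $c\in\mathbb{C}$ the sequence $(f_n)_{n\ge 0}$ is defined by $f_0(z)=z$, $f_1(z)=f(z)$, and $f_n(z)=f_{n-1}(z)f_{n-2}(z)+c$ for $n\ge 2$; $d_n=\deg f_n$, so $d_0=1$, $d_1=\deg f$, $d_{n+1}=d_n+d_{n-1}$ for $n\ge 1$. $\mathcal{K}_c=\{z\in\mathbb{C}:\sup_{n\in\mathbb{N}}|f_n(z)|<+\infty\}$. $\log_+(x)=\max(\log|x|,0)$ (with value $0$ at $x=0$). The polynomial $f$ is fixed independently of $c$. The limit defining $g_c(z)$ exists for every $z\in\mathbb{C}$ (the paper asserts that this definition makes sense together with the theorem). *)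

(* Defs.v *)
From HB Require Import structures.
From mathcomp Require Import all_boot all_order all_algebra.
From mathcomp Require Import complex.
From mathcomp Require Import all_classical all_reals all_analysis.
Set Implicit Arguments.
Unset Strict Implicit.
Unset Printing Implicit Defensive.
Import Order.TTheory GRing.Theory Num.Theory numFieldNormedType.Exports.
Export Normc.
Local Open Scope classical_set_scope.
Local Open Scope ring_scope.
Local Open Scope complex_scope.

(* The library puts the norm topology on every abstract numFieldType (via its
   regular module R^o) but not on the concrete type R[i], which has to be
   declared. The norm `|z| takes values in R[i]; the real-valued modulus is
   normc z. *)
HB.instance Definition _ (R : realType) := NormedModule.copy R[i] R[i]^o.

Section harmonic.
Variable R : realType.
Implicit Types (u : R[i] -> R) (z : R[i]) (U : set R[i]).

(* Partial derivatives with respect to x and y of u, viewed as a function of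
   z = x + iy. *)
Definition pdx u z : R := derive1 (fun t : R => u (z + t%:C)) 0.
Definition pdy u z : R := derive1 (fun t : R => u (z + t *i)) 0.

Definition C1_on U u : Prop :=
  [/\ forall z, U z -> derivable (fun t : R => u (z + t%:C)) 0 1,
      forall z, U z -> derivable (fun t : R => u (z + t *i)) 0 1,
      forall z, U z -> {for z, continuous (pdx u)} &
      forall z, U z -> {for z, continuous (pdy u)}].

Definition C2_on U u : Prop :=
  [/\ C1_on U u, C1_on U (pdx u) & C1_on U (pdy u)].

Definition harmonic_on U u : Prop :=
  [/\ open U, C2_on U u &
      forall z, U z -> pdx (pdx u) z + pdy (pdy u) z = 0].

End harmonic.

Section green.
Variable R : realType.
Implicit Types (f : {poly R[i]}) (c z : R[i]).

Fixpoint fseq f c (n : nat) : {poly R[i]} :=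
  match n with
  | 0 => 'X
  | n1.+1 => match n1 with
             | 0 => f
             | n2.+1 => fseq f c n1 * fseq f c n2 + c%:P
             end
  end.

Definition dseq f c (n : nat) : nat := (size (fseq f c n)).-1.

Definition Kset f c : set R[i] :=
  [set z | has_ubound (range (fun n : nat => normc (fseq f c n).[z]))].

(* ln vanishes at 0 in the library, so logp 0 = 0. *)
Definition logp (x : R) : R := Num.max (ln x) 0.

Definition green_seq f c z (n : nat) : R :=
  (dseq f c n)%:R^-1 * logp (normc (fseq f c n).[z]).

Definition green f c z : R := limn (green_seq f c z).

End green.

(* Main.v *)
Require Import Defs.
From mathcomp Require Import all_boot all_order all_algebra.
From mathcomp Require Import complex ring lra.
From mathcomp Require Import all_classical all_reals all_analysis.
Set Implicit Arguments.
Unset Strict Implicit.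
Unset Printing Implicit Defensive.
Import Order.TTheory GRing.Theory Num.Theory numFieldNormedType.Exports.
Local Open Scope classical_set_scope.
Local Open Scope ring_scope.
Local Open Scope complex_scope.
Local Notation Re := complex.Re.
Local Notation Im := complex.Im.

(** For a Fibonacci-like sequence [d], an estimate
    [x (n+2) = x (n+1) + x n + O(1)] makes [x n / d n] converge geometrically.
    Once two consecutive terms of the orbit [f_n z] exceed [32 + 2 |c|], the
    orbit grows at least like [16 ^ n] and [log |f_n z|] satisfies such an
    estimate, so that the limit exists and is positive.  An unbounded orbit
    must contain two such consecutive terms: otherwise a record value [L] would
    be preceded, a few steps earlier, by a term of order [L ^ 2].

    Continuity is a sandwich: [log+ |f_n| + const] is subadditive along the
    recurrence and [log (|f_n| / 2)] is superadditive on escaping orbits, so that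
    finitely many terms, continuous in [(c, z)], bound [g_c(z)] on both sides.

    Harmonicity avoids complex integration.  With [L_n = f_n' / f_n] and
    [u_n = c / f_(n+2)], one has
    [L_(n+2) = (L_(n+1) + L_n) (1 - u_n)] and [u_n' = - u_n L_(n+2)]; as
    [u_n] is exponentially small, [L_n], [L_n'] and [L_n''] are [O(d_n)] locally
    uniformly, and [L_n / d_n], [L_n' / d_n] converge.  The limit [G] of
    [L_n / d_n] then satisfies [dg/dx = Re G], [dg/dy = Re (i G)], and
    differentiating once more gives [Re (G' + i^2 G') = 0]. *)

(** * Fibonacci-like sequences *)

Section fibonacci_like_sequences.
Variables (R : realType) (d : nat -> nat).
Hypotheses (d0_gt0 : (0 < d 0)%N) (d01 : (d 0 <= d 1)%N).
Hypothesis dSS : forall n, d n.+2 = (d n.+1 + d n)%N.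

Lemma fib_gt0 n : (0 < d n)%N.
Proof.
elim/ltn_ind: n => -[|[|n]] ih //; first exact: leq_trans d01.
by rewrite dSS addn_gt0 ih.
Qed.

Lemma fib_le n : (d n <= d n.+1)%N.
Proof. by case: n => [//|n]; rewrite dSS leq_addr. Qed.

Lemma fib_natr_gt0 n : 0 < (d n)%:R :> R.
Proof. by rewrite ltr0n fib_gt0. Qed.

Lemma fib_natr_ge1 n : 1 <= (d n)%:R :> R.
Proof. by rewrite ler1n fib_gt0. Qed.

Lemma fib_natrSS n : (d n.+2)%:R = (d n.+1)%:R + (d n)%:R :> R.
Proof. by rewrite dSS natrD. Qed.

Lemma fib_natr_le n : (d n)%:R <= (d n.+1)%:R :> R.
Proof. by rewrite ler_nat fib_le. Qed.

(** As [d 1] may exceed [2 * d 0], the ratio 3/2 is guaranteed only from index 2 on, where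
    $d_{n+2}\le 2d_{n+1}$ yields $d_{n+3}\ge\frac32 d_{n+2}$. This explains the shift. *)
Lemma fib_growth n : (3 / 2) ^+ n <= (d n.+2)%:R :> R.
Proof.
elim: n => [|n ih]; first by rewrite expr0 fib_natr_ge1.
rewrite exprS fib_natrSS.
have := fib_natr_le n.+1; have := fib_natrSS n; have := fib_natr_le n.
by move: ih; move: ((3 / 2) ^+ n) => e *; lra.
Qed.

(** The crude rate 2 suffices: its cube 8 stays below the rate 16 at which escaping orbits grow, and
    [fib_jets] needs no more. *)
Lemma fib_le_expr2 n : (d n)%:R <= (d 1)%:R * 2 ^+ n :> R.
Proof.
suff [] : (d n)%:R <= (d 1)%:R * 2 ^+ n :> R /\
          (d n.+1)%:R <= (d 1)%:R * 2 ^+ n :> R by [].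
elim: n => [|n [ih1 ih2]].
  by rewrite expr0 mulr1; split => //; rewrite ler_nat.
rewrite exprS mulrCA; have := fib_natrSS n; have := fib_natr_le n.
have := fib_natr_ge1 n.
by move: ih1 ih2; move: (_ * 2 ^+ n) => e *; split; lra.
Qed.

Lemma fib_cvgy : (d n)%:R^-1 @[n --> \oo] --> (0 : R).
Proof.
rewrite -(cvg_shiftn 2).
apply: (@squeeze_cvgr _ _ _ _ (fun _ => 0) (fun n => (2 / 3 : R) ^+ n)).
- apply: nearW => n; rewrite /= addnC invr_ge0 ler0n /=.
  rewrite -[2 / 3]invf_div exprVn lef_pV2 ?fib_growth //.
    by rewrite posrE fib_natr_gt0.
  by rewrite posrE exprn_gt0 //; lra.
- exact: cvg_cst.
- by apply: cvg_expr; rewrite ger0_norm; lra.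
Qed.

(* The increments [b] of [x n / d n] satisfy [b (n+1) <= b n / 2 + C / d (n+2)],
   hence decrease geometrically. *)
Lemma fib_ratio_cvg (x : nat -> R) (C : R) :
  (forall n, `|x n.+2 - x n.+1 - x n| <= C) -> cvgn (fun n => x n / (d n)%:R).
Proof.
move=> xC; pose a n := x n / (d n)%:R.
have C0 : 0 <= C by apply: le_trans (xC 0%N).
(* The factor 6 comes from $\frac12+\frac16=\frac23$: with $C\le K/6$, the halved previous increment
   and the new error together stay below $\frac23 K(2/3)^n$. *)
pose K := `|a 1%N - a 0%N| + 6 * C.
have K6 : 6 * C <= K by rewrite lerDr.
have aK n : `|a n.+1 - a n| <= K * (2 / 3) ^+ n.
  elim: n => [|n ih]; first by rewrite expr0 mulr1 /K lerDl; lra.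
  have [D0 D1 D2] : [/\ (d n)%:R != 0 :> R, (d n.+1)%:R != 0 :> R
                      & (d n.+1)%:R + (d n)%:R != 0 :> R].
    by rewrite -fib_natrSS; split; rewrite gt_eqF ?fib_natr_gt0.
  have -> : a n.+2 - a n.+1 = - ((d n)%:R / (d n.+2)%:R * (a n.+1 - a n))
      + (x n.+2 - x n.+1 - x n) / (d n.+2)%:R.
    by rewrite /a fib_natrSS; field; rewrite D0 D1 D2.
  apply: le_trans (ler_normD _ _) _; rewrite normrN !normrM !normfV !normr_nat.
  have h1 : (d n)%:R / (d n.+2)%:R <= 1 / 2 :> R.
    rewrite ler_pdivrMr ?fib_natr_gt0 //.
    by have := fib_natrSS n; have := fib_natr_le n; lra.
  have h2 : (d n.+2)%:R^-1 <= (2 / 3) ^+ n :> R.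
    rewrite -[2 / 3]invf_div exprVn lef_pV2 ?fib_growth //.
      by rewrite posrE fib_natr_gt0.
    by rewrite posrE exprn_gt0 //; lra.
  have h3 := ler_pM (divr_ge0 (ler0n _ _) (ler0n _ _)) (normr_ge0 _) h1 ih.
  have h4 : `|x n.+2 - x n.+1 - x n| * (d n.+2)%:R^-1 <= C * (2 / 3) ^+ n.
    by apply: ler_pM; rewrite ?invr_ge0.
  have e0 : 0 <= (2 / 3) ^+ n :> R by apply: exprn_ge0; lra.
  have := ler_wpM2r e0 K6.
  rewrite exprS; move: h3 h4 e0; move: ((2 / 3) ^+ n) => e *; lra.
have : cvgn (series (fun n => a n.+1 - a n)).
  apply: normed_cvg; apply: (@series_le_cvg _ _ (geometric K (2 / 3))) => [n|n|n|].
  - exact: normr_ge0.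
  - by rewrite /= mulr_ge0 ?exprn_ge0 //; lra.
  - exact: aK.
  - by apply: is_cvg_geometric_series; rewrite ger0_norm; lra.
rewrite (_ : series _ = fun n => a n - a 0%N); last first.
  by apply/funext => n; rewrite /series /= telescope_sumr.
move=> cv; rewrite -[X in cvgn X](_ : (fun n => a n - a 0%N + a 0%N) = _).
  exact: is_cvgD cv (is_cvg_cst _).
by apply/funext => n; rewrite subrK.
Qed.

(* The bound [B] depends only on [d], [B0] and [K], so that it applies
   uniformly to families of sequences. *)
Lemma fib_gronwall (B0 K : R) : 0 <= K -> exists B, forall x : nat -> R,
  x 0%N <= B0 -> x 1%N <= B0 ->
  (forall n, x n.+2 <= (x n.+1 + x n) * (1 + K / 2 ^+ n) + K / 2 ^+ n) ->
  forall n, x n <= B * (d n)%:R.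
Proof.
move=> K0.
pose A := `|B0| + 1.
(* Since $2-2/2^n=\sum_{j<n}2^{-j}$, [Q n] dominates the product of the factors $1+K/2^j$ for $j<n$,
   and it is bounded by $Ae^{2K}$. *)
pose Q n : R := A * expR (K * (2 - 2 / 2 ^+ n)).
have A1 : 1 <= A by rewrite lerDr.
have QS n : Q n * (1 + K / 2 ^+ n) <= Q n.+1.
  rewrite (_ : Q n.+1 = Q n * expR (K / 2 ^+ n)); last first.
    rewrite /Q -mulrA -expRD exprS; congr (_ * expR _); field.
    by rewrite expf_neq0.
  by rewrite ler_wpM2l ?expR_ge1Dx // mulr_ge0 ?expR_ge0 //; lra.
have KV n : 0 <= K / 2 ^+ n by rewrite divr_ge0 // exprn_ge0.
have Q1 n : 1 <= Q n.
  elim: n => [|n ih]; first by rewrite /Q expr0 divr1 subrr mulr0 expR0 mulr1.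
  apply: le_trans ih _; apply: le_trans (QS n).
  by rewrite ler_peMr ?lerDl // mulr_ge0 ?expR_ge0 //; lra.
exists (A * expR (K * 2)) => x x0 x1 xSS.
(* The [- 1] absorbs the additive error: multiplying [Q n - 1] by $1+K/2^n$ leaves a slack of
   $K/2^n$ times a degree that is at least 1. *)
have xQ n : x n <= (Q n - 1) * (d n)%:R /\ x n.+1 <= (Q n - 1) * (d n.+1)%:R.
  elim: n => [|n [ih1 ih2]].
    have -> : Q 0%N - 1 = `|B0|.
      by rewrite /Q expr0 divr1 subrr mulr0 expR0 mulr1 addrK.
    split; [apply: le_trans x0 _|apply: le_trans x1 _];
    by rewrite (le_trans (ler_norm _))// ler_peMr // fib_natr_ge1.
  have QnS : Q n <= Q n.+1.
    by apply: le_trans (QS n); rewrite ler_peMr ?lerDl //; have := Q1 n; lra.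
  split; first by apply: le_trans ih2 _; rewrite ler_wpM2r // lerB.
  apply: le_trans (xSS n) _; rewrite fib_natrSS.
  apply: (@le_trans _ _ ((Q n * (1 + K / 2 ^+ n) - 1) * ((d n.+1)%:R + (d n)%:R))).
    have dd : 1 <= (d n.+1)%:R + (d n)%:R :> R.
      by rewrite -fib_natrSS fib_natr_ge1.
    have k0 := KV n; have q1 := Q1 n.
    have := ler_wpM2r (addr_ge0 ler01 k0) (lerD ih2 ih1).
    have := ler_wpM2l k0 dd.
    move: (K / 2 ^+ n) (Q n) => k q; nra.
  by rewrite ler_wpM2r ?addr_ge0 // lerB.
move=> n; apply: le_trans (proj1 (xQ n)) _; rewrite ler_wpM2r //.
apply: (@le_trans _ _ (Q n)); first by rewrite lerBlDr lerDl.
rewrite ler_wpM2l ?(le_trans ler01) // ler_expR ler_wpM2l //.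
by rewrite lerBlDr lerDl divr_ge0 // exprn_ge0.
Qed.

(** The sequence [e * d n] solves the recurrence exactly, so a comparison at two consecutive indices
    propagates to all later ones. *)
Lemma fib_superadditive_ge (x : nat -> R) (e : R) :
  (forall n, x n.+1 + x n <= x n.+2) ->
  e * (d 0)%:R <= x 0%N -> e * (d 1)%:R <= x 1%N -> forall n, e * (d n)%:R <= x n.
Proof.
move=> xS x0 x1; elim/ltn_ind => -[|[|n]] ih //.
by rewrite fib_natrSS mulrDr (le_trans _ (xS n)) // lerD ?ih.
Qed.

Lemma fib_subadditive_le (x : nat -> R) (e : R) :
  (forall n, x n.+2 <= x n.+1 + x n) ->
  x 0%N <= e * (d 0)%:R -> x 1%N <= e * (d 1)%:R -> forall n, x n <= e * (d n)%:R.
Proof.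
move=> xS x0 x1; elim/ltn_ind => -[|[|n]] ih //.
by rewrite fib_natrSS mulrDr (le_trans (xS n)) // lerD ?ih.
Qed.

End fibonacci_like_sequences.

(** * The real-valued modulus on complex numbers *)

Section modulus.
Variable R : realType.
Implicit Types x y z : R[i].

Lemma normc_ge0 z : 0 <= normc z.
Proof. by case: z => a b; apply: sqrtr_ge0. Qed.

Lemma normc_eq0 z : (normc z == 0) = (z == 0).
Proof.
by apply/eqP/eqP => [/eq0_normc //|->]; rewrite normc0.
Qed.

Lemma normc_gt0 z : (0 < normc z) = (z != 0).
Proof. by rewrite lt_def normc_ge0 andbT normc_eq0. Qed.

Lemma normc_addr_le x y : normc (x + y) <= normc x + normc y.
Proof. exact: le_normcD. Qed.

Lemma normc_addr_ge x y : normc x - normc y <= normc (x + y).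
Proof.
by rewrite lerBlDr -(normcN y) (le_trans _ (normc_addr_le _ _)) // addrK.
Qed.

Lemma normc_real (t : R) : normc t%:C = `|t|.
Proof. by rewrite /normc /= expr0n addr0 sqrtr_sqr. Qed.

Lemma normc_norm z : `|z| = (normc z)%:C.
Proof. by case: z. Qed.

Lemma ltc_norm z (e : R) : (`|z| < e%:C) = (normc z < e).
Proof. by rewrite normc_norm ltcR. Qed.

Lemma normr_Re_le z : `|Re z| <= normc z.
Proof.
by case: z => a b /=; rewrite -sqrtr_sqr ler_wsqrtr // lerDl sqr_ge0.
Qed.

Lemma normcX z n : normc (z ^+ n) = normc z ^+ n.
Proof. by elim: n => [|n ih]; rewrite ?expr0 ?normc1 // !exprS normcM ih. Qed.

Lemma normc_sum (I : Type) (r : seq I) (P : pred I) (F : I -> R[i]) :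
  normc (\sum_(i <- r | P i) F i) <= \sum_(i <- r | P i) normc (F i).
Proof.
elim/big_ind2 : _ => [|x1 y1 x2 y2 h1 h2|//]; first by rewrite normc0.
by apply: le_trans (normc_addr_le _ _) _; apply: lerD.
Qed.

Lemma ln_normc1D x : normc x <= 1 / 2 -> `|ln (normc (1 + x))| <= 2 * normc x.
Proof.
move=> x2; have x0 := normc_ge0 x.
have lo : 1 - normc x <= normc (1 + x).
  by have := normc_addr_ge 1 x; rewrite normc1.
have hi : normc (1 + x) <= 1 + normc x.
  by have := normc_addr_le 1 x; rewrite normc1.
have p0 : 0 < normc (1 + x) by apply: lt_le_trans lo; lra.
rewrite ler_norml; apply/andP; split.
  rewrite lerNl -lnV ?posrE //.
  (* For $0\le r\le\frac12$ one has $1/(1-r)\le 1+2r$, so the lower bound on the logarithm also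
     follows from $\ln(1+y)\le y$. *)
  apply: (@le_trans _ _ (ln (1 + 2 * normc x))); last first.
    by apply: le_trans (le_ln1Dx _) _; lra.
  rewrite ler_ln ?posrE ?invr_gt0 //; last lra.
  rewrite -[leRHS]invrK lef_pV2 ?posrE ?invr_gt0 //; last lra.
  apply: le_trans lo; rewrite -div1r ler_pdivrMr; last lra.
  by move: (normc x) x0 x2 => r *; nra.
apply: (@le_trans _ _ (ln (1 + normc x))); first by rewrite ler_ln ?posrE //; lra.
by apply: le_trans (le_ln1Dx _) _; lra.
Qed.

End modulus.

(** * Escaping orbits *)

Section escape.
Variables (R : realType) (m : nat -> R) (k : R).
Hypotheses (m_ge0 : forall n, 0 <= m n) (k0 : 0 <= k).
Hypothesis m_le : forall n, m n.+2 <= m n.+1 * m n + k.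
Hypothesis m_ge : forall n, m n.+1 * m n - k <= m n.+2.

Local Ltac klra := have ? := k0; lra.

Section large_pair.
Hypotheses (m0 : 32 + 2 * k <= m 0%N) (m1 : 32 + 2 * k <= m 1%N).

(** This is where the threshold [32 + 2 * k] acts. The product exceeds [2 * k], so adding an error
    of size [k] changes it by at most a factor 2; the 32, halved in this way, leaves the growth
    factor 16. *)
Let prod_ge (x y : R) : 32 + 2 * k <= x -> 32 + 2 * k <= y ->
  32 * y <= y * x /\ 1024 + 64 * k <= y * x.
Proof.
move=> hx hy; have x32 : 32 <= x by klra.
have y0 : 0 <= y by klra.
have h := ler_wpM2l y0 x32; split; klra.
Qed.

Lemma escape_ge n : 32 + 2 * k <= m n.
Proof.
elim/ltn_ind: n => -[|[|n]] ih //.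
have := m_ge n; have [] := prod_ge (ih n (leqnSn _)) (ih n.+1 (leqnn _)).
by move: (m n.+1 * m n) => p *; klra.
Qed.

Lemma escape_lower n : m n.+1 * m n <= 2 * m n.+2.
Proof.
have := m_ge n; have [] := prod_ge (escape_ge n) (escape_ge n.+1).
by move: (m n.+1 * m n) => p *; klra.
Qed.

Lemma escape_upper n : m n.+2 <= 2 * (m n.+1 * m n).
Proof.
have := m_le n; have [] := prod_ge (escape_ge n) (escape_ge n.+1).
by move: (m n.+1 * m n) => p *; klra.
Qed.

Lemma escape_ge_mono (T : R) : T <= m 0%N -> T <= m 1%N -> forall n, T <= m n.
Proof.
move=> T0 T1; elim/ltn_ind => -[|[|n]] ih //.
apply: le_trans (ih n.+1 (leqnn _)) _; have := escape_lower n.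
have [] := prod_ge (escape_ge n) (escape_ge n.+1); have := escape_ge n.+1.
by move: (m n.+1 * m n) => p *; klra.
Qed.

Lemma escape_growth n : 16 ^+ n <= m n.
Proof.
elim/ltn_ind: n => -[|[|n]] ih; first by rewrite expr0; have ? := m0; klra.
  by rewrite expr1; have ? := m1; klra.
rewrite exprS; have := ih n.+1 (leqnn _).
have := escape_lower n; have [] := prod_ge (escape_ge n) (escape_ge n.+1).
by move: (16 ^+ n.+1) (m n.+1 * m n) => e p *; klra.
Qed.

(** Dividing every term by 2 turns the factor 2 lost in [escape_lower] into exact superadditivity,
    the form that [fib_superadditive_ge] accepts. Doubling the terms plays the same part for
    [escape_ln_upper]. *)
Lemma escape_ln_lower n :
  ln (m n.+1 / 2) + ln (m n / 2) <= ln (m n.+2 / 2).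
Proof.
have le2 := escape_lower n.
have e0 j : 0 < m j by have := escape_ge j; klra.
rewrite -lnM ?posrE ?divr_gt0 // ler_ln ?posrE ?mulr_gt0 ?invr_gt0 //.
by rewrite mulrACA; klra.
Qed.

Lemma escape_ln_upper n :
  ln (2 * m n.+2) <= ln (2 * m n.+1) + ln (2 * m n).
Proof.
have le2 := escape_upper n.
have e0 j : 0 < m j by have := escape_ge j; klra.
rewrite -lnM ?posrE ?mulr_gt0 // ler_ln ?posrE ?mulr_gt0 //.
by rewrite mulrACA; klra.
Qed.

Lemma escape_ln_defect n :
  `|ln (m n.+2) - ln (m n.+1) - ln (m n)| <= ln 2.
Proof.
have e0 j : 0 < m j by have := escape_ge j; klra.
have := escape_ln_upper n; have := escape_ln_lower n.
rewrite !lnM ?posrE ?e0 ?invr_gt0 // lnV ?posrE // => *.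
by rewrite ler_norml; apply/andP; split; klra.
Qed.

End large_pair.

(** A maximum over an initial segment is a record. Taking the level above the sum of the first five
    terms forces its index to be at least 5, so that five predecessors exist. *)
Lemma exists_record (T : R) : ~ has_ubound (range m) ->
  exists n, T < m n.+4.+1 /\ forall j, (j <= n.+4.+1)%N -> m j <= m n.+4.+1.
Proof.
move=> nb; pose S := `|T| + \sum_(j < 5) m j.
have [N mN] : exists N, S < m N.
  apply/not_existsP => h; apply: nb; exists S => _ [n _ <-].
  by rewrite leNgt; apply/negP.
case: (@arg_maxP _ R _ (ord0 : 'I_N.+1) xpredT m isT) => i _ imax.
have SI : S < m i by apply: lt_le_trans mN (imax ord_max isT).
have TS : T < m i.
  apply: le_lt_trans SI; apply: le_trans (ler_norm _) _.
  by rewrite lerDl sumr_ge0.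
case: (ltnP i 5) => i5.
  move: SI; rewrite ltNge /S (bigD1 (Ordinal i5)) //= addrCA lerDl.
  by rewrite addr_ge0 ?normr_ge0 // sumr_ge0.
have e5 : (i - 5).+4.+1 = i by rewrite -[RHS](subnK i5) !addnS addn0.
exists (i - 5)%N; rewrite e5; split=> // j ji.
have jN : (j < N.+1)%N by apply: leq_ltn_trans ji _.
exact: (imax (Ordinal jN)).
Qed.

(* If [m (j+2)] is large while [m (j+3)] is small, then [m (j+1)] is tiny, and
   [m j] has the order of [m (j+2) ^ 2]. *)
Lemma small_after_large (P r : R) j : m j.+3 <= r ->
  m j <= P -> m j.+2 ^+ 2 <= (r + k) * P + k * m j.+2.
Proof.
move=> s jP; have := m_ge j.+1; have := m_le j; have := m_ge0 j.+1.
have := m_ge0 j; have := m_ge0 j.+2; move: s jP.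
move: (m j) (m j.+1) (m j.+2) (m j.+3) => a b c e s jP c0 a0 b0 h1 h2.
have h3 : c * b <= r + k by klra.
have h4 := ler_wpM2r c0 h1; have h5 := ler_wpM2r a0 h3.
have h6 : 0 <= r + k by apply: le_trans h3; apply: mulr_ge0.
have h7 := ler_wpM2l h6 jP.
by rewrite expr2; klra.
Qed.

(* At a record [L], a failure would produce an earlier term of order [L ^ 2]. *)
Lemma exists_large_pair (r : R) : ~ has_ubound (range m) ->
  exists n, r <= m n /\ r <= m n.+1.
Proof.
move=> nb; pose q : R := `|r| + 1.
have q1 : 1 <= q by rewrite lerDr.
have rq : r <= q by apply: le_trans (ler_norm r) _; rewrite lerDl.
apply/not_existsP => small.
have {}small n : m n.+1 < q \/ m n < q.
  case: (ltP (m n.+1) q) => [|h1]; first by left.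
  case: (ltP (m n) q) => [|h2]; first by right.
  by exfalso; apply: (small n); split; apply: le_trans rq _.
(* The second summand makes all the error terms in [k] negligible against [L]; the first is the
   bound on [L] that [key] derives, so that exceeding [M] is contradictory. *)
pose M : R := 32 * q ^+ 4 * (q + k) + 8 * q ^+ 2 * k.
have [n [Mn rec]] := exists_record M nb.
have := small n.+3; have := m_le n.+3; have := m_le n.+2.
have := rec n.+1 (leqW (leqW (leqW (leqnSn _)))).
have := rec n (leqW (leqW (leqW (leqW (leqnSn _))))).
move: Mn; set L := m n.+4.+1 => ML nL n1L h2 h1.
have k2 : k <= q ^+ 2 * k by rewrite ler_peMl // exprn_ege1.
have q2 : q <= q ^+ 2 by rewrite expr2 ler_peMl //; klra.
have q3 : 1 <= q ^+ 2 by apply: exprn_ege1.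
have M0 : 0 <= M by rewrite addr_ge0 ?mulr_ge0 ?exprn_ge0 //; klra.
have L0 : 0 < L by apply: le_lt_trans ML.
have L8 : 8 * q ^+ 2 * k <= L.
  apply: ltW; apply: le_lt_trans ML; rewrite lerDr.
  by rewrite !mulr_ge0 ?exprn_ge0 //; klra.
(* A term [x] comparable to [L] whose square is only of order [L] bounds [L]: as $kx\le x^2/2$, one
   gets $x^2\le 2(q+k)L$, hence $L^2\le 16q^4x^2\le 32q^4(q+k)L$. *)
have key (x : R) : x <= L -> L <= 4 * q ^+ 2 * x -> x ^+ 2 <= (q + k) * L + k * x -> False.
  move=> xL Lx hx.
  have x0 : 0 < x.
    have : 0 < 4 * q ^+ 2 * x by apply: lt_le_trans Lx.
    by rewrite pmulr_rgt0 // pmulr_rgt0 // exprn_gt0 //; klra.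
  have kx : 2 * k <= x.
    have q4 : 0 < 4 * q ^+ 2 by klra.
    by rewrite -(ler_pM2l q4); klra.
  have h3 : x ^+ 2 <= 2 * ((q + k) * L).
    have := ler_wpM2r (ltW x0) kx; rewrite expr2 in hx *; klra.
  have h4 : L ^+ 2 <= 16 * q ^+ 4 * x ^+ 2.
    have -> : 16 * q ^+ 4 * x ^+ 2 = (4 * q ^+ 2 * x) ^+ 2 by ring.
    by rewrite ler_sqr ?nnegrE // ltW // ?(lt_le_trans L0).
  have q40 : 0 <= 16 * q ^+ 4 by rewrite mulr_ge0 ?exprn_ge0 //; klra.
  have h5 := ler_wpM2l q40 h3.
  have : L * L <= 32 * q ^+ 4 * (q + k) * L by rewrite -expr2; klra.
  rewrite ler_pM2r // => h6; move: ML; rewrite ltNge => /negP; apply.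
  apply: le_trans h6 _; rewrite lerDl.
  by rewrite !mulr_ge0 ?exprn_ge0 //; klra.
have x0 : 0 <= m n.+3 by [].
have y0 : 0 <= m n.+4 by [].
(* One of the two terms before the record is below [q]. If it is [m n.+4], then [x] is [m n.+3], one
   factor [q] away from [L]. Otherwise [m n.+3] is small and [x] is [m n.+2], two factors [q] away.
   In both cases [x] precedes a small term, as [small_after_large] requires. *)
case: (ltP (m n.+4) q) => [s1 _|l1 [|s2]].
- apply: (@key (m n.+3)).
  + exact: rec (leqW (leqnSn _)).
  + have := ler_wpM2r x0 (ltW s1); have := ler_wpM2r x0 q2; move=> *; klra.
  + exact: small_after_large (ltW s1) n1L.
- by [].
- apply: (@key (m n.+2)).
  + exact: rec (leqW (leqW (leqnSn _))).
  + have z0 : 0 <= m n.+2 by [].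
    have a1 : m n.+4 <= q * m n.+2 + k.
      by apply: le_trans h2 _; rewrite lerD2r ler_wpM2r // ltW.
    have a2 : L <= q * m n.+4 + k.
      by apply: le_trans h1 _; rewrite lerD2r mulrC ler_wpM2r // ltW.
    have a3 : q * m n.+4 <= q * (q * m n.+2 + k) by rewrite ler_wpM2l //; klra.
    have a4 : q * k <= q ^+ 2 * k by rewrite ler_wpM2r.
    by rewrite mulrDr mulrA -expr2 in a3; klra.
  + exact: small_after_large (ltW s2) nL.
Qed.

End escape.

(** * Derivatives along lines *)

Section real_derivatives.
Variable R : realType.
Implicit Types f g phi psi chi : R -> R.

Lemma is_derive_mul f g (t a b : R) : is_derive t 1 f a -> is_derive t 1 g b ->
  is_derive t 1 (fun s => f s * g s) (f t * b + g t * a).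
Proof. by move=> fa gb; exact: is_deriveM. Qed.

Lemma is_derive_add f g (t a b : R) : is_derive t 1 f a -> is_derive t 1 g b ->
  is_derive t 1 (fun s => f s + g s) (a + b).
Proof. by move=> fa gb; exact: is_deriveD. Qed.

Lemma is_derive_sub f g (t a b : R) : is_derive t 1 f a -> is_derive t 1 g b ->
  is_derive t 1 (fun s => f s - g s) (a - b).
Proof. by move=> fa gb; exact: is_deriveB. Qed.

Lemma is_derive_inv f (t a : R) : is_derive t 1 f a -> f t != 0 ->
  is_derive t 1 (fun s => (f s)^-1) (- a / f t ^+ 2).
Proof.
move=> [df <-] ft0; apply: DeriveDef; first exact: derivableV.
by rewrite deriveV // scaleNr mulNr [in RHS]mulrC.
Qed.

(** A quadratic remainder bound passes to pointwise limits, which differentiability alone does not;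
    a limit function is recognised as differentiable through it. *)
Lemma is_derive_quadratic f (a M r : R) : 0 < r ->
  (forall t : R, `|t| < r -> `|f t - f 0 - t * a| <= M * t ^+ 2) ->
  is_derive (0 : R) 1 f a.
Proof.
move=> r0 fM.
have cv : h^-1 *: ((f \o shift 0) (h *: 1) - f 0) @[h --> 0^'] --> a.
  apply/cvgrPdist_le => e e0; near=> h.
  have h0 : h != 0 by near: h; exact: nbhs_dnbhs_neq.
  rewrite /= addr0 [h *: 1]mulr1.
  have hr : `|h| < r by near: h; exact: dnbhs0_lt.
  have he : `|h| <= e / (`|M| + 1).
    by near: h; apply: dnbhs0_le; rewrite divr_gt0 // ltr_pwDr.
  have -> : a - h^-1 *: (f h - f 0) = - (h^-1 * (f h - f 0 - h * a)).
    by rewrite /GRing.scale /=; field.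
  rewrite normrN normrM normfV ler_pdivrMl ?normr_gt0 //.
  apply: le_trans (fM _ hr) _; rewrite -real_normK ?num_real // expr2 mulrCA.
  rewrite ler_wpM2l //; apply: le_trans (_ : `|M| * `|h| <= _).
    by rewrite ler_wpM2r // ler_norm.
  rewrite ler_pdivlMr in he; last by rewrite ltr_pwDr.
  by rewrite mulrC; apply: le_trans he; rewrite ler_wpM2l // lerDl.
apply: DeriveDef; first by apply/cvg_ex; exists a.
exact: cvg_lim cv.
Unshelve. all: by end_near. Qed.

Lemma is_derive_continuous_within phi psi (a b : R) :
  (forall x : R, x \in `[a, b] -> is_derive x 1 phi (psi x)) ->
  {within `[a, b], continuous phi}.
Proof.
move=> d; apply: derivable_within_continuous => x xab.
by have [] := d x xab.
Qed.

(** The endpoints come in no particular order, and of the intermediate point only a bound on its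
    modulus is kept. This lets the lemma be applied again at that point. *)
Lemma MVT_ball phi psi (r s t : R) :
  (forall x : R, `|x| < r -> is_derive x 1 phi (psi x)) -> `|s| < r -> `|t| < r ->
  exists2 c, `|c| <= Num.max `|s| `|t| & phi t - phi s = psi c * (t - s).
Proof.
move=> d; wlog st : s t / s <= t.
  move=> H sr tr; have [st|/ltW ts] := leP s t; first exact: H.
  have [c cb e] := H t s ts tr sr; exists c; first by rewrite maxC.
  by rewrite -opprB e -mulrN opprB.
move=> sr tr.
have inr x : x \in `[s, t] -> `|x| <= Num.max `|s| `|t|.
  rewrite in_itv /= => /andP[sx xt]; rewrite le_max.
  case: (leP 0 x) => x0; apply/orP; [right|left].
    by rewrite !ger0_norm // (le_trans x0).
  by rewrite !ler0_norm ?lerN2 // ltW // (le_lt_trans sx).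
have dd x : x \in `[s, t] -> is_derive x 1 phi (psi x).
  by move=> xst; apply: d; apply: le_lt_trans (inr _ xst) _; rewrite gt_max sr tr.
have dd' x : x \in `]s, t[ -> is_derive x 1 phi (psi x).
  by move=> xst; apply: dd; apply: subset_itv_oo_cc xst.
have cont := is_derive_continuous_within dd.
have [c cst e] := @MVT_segment R phi psi s t st dd' cont.
by exists c; first exact: inr.
Qed.

(** Two uses of the mean value theorem write the remainder as [chi u * c * t] with $|c|\le|t|$. The
    constant is [M] rather than $M/2$, which costs nothing here. *)
Lemma taylor1_bound phi psi chi (r M t : R) :
  (forall x : R, `|x| < r -> is_derive x 1 phi (psi x)) ->
  (forall x : R, `|x| < r -> is_derive x 1 psi (chi x)) ->
  (forall x : R, `|x| < r -> `|chi x| <= M) -> `|t| < r ->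
  `|phi t - phi 0 - t * psi 0| <= M * t ^+ 2.
Proof.
move=> d1 d2 chiM tr.
have r0 : `|0 : R| < r by rewrite normr0 (le_lt_trans _ tr).
have [c ct e1] := MVT_ball d1 r0 tr.
rewrite normr0 max_r // in ct.
have cr : `|c| < r by apply: le_lt_trans tr.
have [u uc e2] := MVT_ball d2 r0 cr.
rewrite normr0 max_r // in uc.
have ur : `|u| < r by apply: le_lt_trans cr.
rewrite subr0 in e1; rewrite subr0 in e2.
have -> : phi t - phi 0 - t * psi 0 = chi u * c * t by rewrite e1 -e2; ring.
rewrite !normrM -[t ^+ 2]real_normK ?num_real // expr2 mulrA.
by rewrite ler_wpM2r // ler_pM // chiM.
Qed.

(* Pointwise convergence of [phi] and [psi] is enough: the bound on the second
   derivatives makes the Taylor remainder uniform in [n]. *)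
Lemma is_derive_limit (phi psi chi : nat -> R -> R) (l : R -> R) (a r M : R) :
  0 < r ->
  (forall n (x : R), `|x| < r -> is_derive x 1 (phi n) (psi n x)) ->
  (forall n (x : R), `|x| < r -> is_derive x 1 (psi n) (chi n x)) ->
  (forall n (x : R), `|x| < r -> `|chi n x| <= M) ->
  (forall x : R, `|x| < r -> phi n x @[n --> \oo] --> l x) ->
  psi n 0 @[n --> \oo] --> a -> is_derive (0 : R) 1 l a.
Proof.
move=> r0 d1 d2 chiM cphi cpsi; apply: (is_derive_quadratic r0 (M := M)) => t tr.
have cv : `|phi n t - phi n 0 - t * psi n 0| @[n --> \oo] -->
    `|l t - l 0 - t * a|.
  apply: cvg_norm; apply: cvgB; last by apply: cvgM => //; exact: cvg_cst.
  by apply: cvgB; [apply: (cphi t)|apply: (cphi 0)]; rewrite ?normr0.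
apply: (cvgr_to_le cv).
by apply: nearW => n; exact: taylor1_bound (d1 n) (d2 n) (chiM n) tr.
Qed.

End real_derivatives.

(** * Complex-valued functions of a real parameter *)

Section complex_derivatives.
Variable R : realType.
Implicit Types (F G : R -> R[i]) (z v : R[i]).

Lemma ReM z v : Re (z * v) = Re z * Re v - Im z * Im v.
Proof. by case: z v => a b [c d]. Qed.

Lemma ImM z v : Im (z * v) = Re z * Im v + Im z * Re v.
Proof. by case: z v => a b [c d]. Qed.

Lemma ReD z v : Re (z + v) = Re z + Re v.
Proof. by case: z v => a b [c d]. Qed.

Lemma ImD z v : Im (z + v) = Im z + Im v.
Proof. by case: z v => a b [c d]. Qed.

(** The derivative of a curve in the plane is kept componentwise, so that the real differentiation
    rules apply to each part. *)
Definition cderive F (t : R) (dF : R[i]) : Prop :=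
  is_derive t 1 (fun s => Re (F s)) (Re dF) /\
  is_derive t 1 (fun s => Im (F s)) (Im dF).

Lemma cderive_ext F G t z : F =1 G -> cderive F t z -> cderive G t z.
Proof. by move=> /funext ->. Qed.

Lemma cderive_cst z t : cderive (fun=> z) t 0.
Proof. by split; exact: is_derive_cst. Qed.

Lemma cderive_add F G t z v : cderive F t z -> cderive G t v ->
  cderive (fun s => F s + G s) t (z + v).
Proof.
move=> [F1 F2] [G1 G2]; split.
  by rewrite ReD; under eq_fun do rewrite ReD; exact: is_derive_add.
by rewrite ImD; under eq_fun do rewrite ImD; exact: is_derive_add.
Qed.

Lemma cderive_mul F G t z v : cderive F t z -> cderive G t v ->
  cderive (fun s => F s * G s) t (z * G t + F t * v).
Proof.
move=> [F1 F2] [G1 G2]; split.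
  under eq_fun do rewrite ReM.
  have d := is_derive_sub (is_derive_mul F1 G1) (is_derive_mul F2 G2).
  apply: (is_derive_eq d).
  by rewrite ReD !ReM; ring.
under eq_fun do rewrite ImM.
have d := is_derive_add (is_derive_mul F1 G2) (is_derive_mul F2 G1).
apply: (is_derive_eq d).
by rewrite ImD !ImM; ring.
Qed.

Lemma Re_inv z : Re z^-1 = Re z * (Re z * Re z + Im z * Im z)^-1.
Proof. by case: z => a b. Qed.

Lemma Im_inv z : Im z^-1 = - (Im z * (Re z * Re z + Im z * Im z)^-1).
Proof. by case: z => a b. Qed.

Lemma sqr_ReIm_neq0 z : z != 0 -> Re z * Re z + Im z * Im z != 0.
Proof.
move=> z0; rewrite -!expr2 paddr_eq0 ?sqr_ge0 // !sqrf_eq0.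
by case: z z0 => a b; rewrite eq_complex.
Qed.

Lemma cderive_inv F t z : F t != 0 -> cderive F t z ->
  cderive (fun s => (F s)^-1) t (- z / F t ^+ 2).
Proof.
move=> Ft0 [F1 F2]; have N0 := sqr_ReIm_neq0 Ft0.
have E : - z / F t ^+ 2 = - z * ((F t)^-1 * (F t)^-1) by rewrite expr2 invfM.
have dN := is_derive_inv (is_derive_add (is_derive_mul F1 F1) (is_derive_mul F2 F2)) N0.
split.
  under eq_fun do rewrite Re_inv.
  apply: (is_derive_eq (is_derive_mul F1 dN)).
  rewrite E ReM [Re (_ * _)]ReM [Im (_ * _)]ImM !Re_inv !Im_inv.
  by case: z F1 F2 {dN E} => a b _ _ /=; field.
under eq_fun do rewrite Im_inv.
apply: (is_derive_eq (is_deriveN (is_derive_mul F2 dN))).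
rewrite E ImM [Re (_ * _)]ReM [Im (_ * _)]ImM !Re_inv !Im_inv.
by case: z F1 F2 {dN E} => a b _ _ /=; field.
Qed.

Lemma cderive_div F G t z v : G t != 0 -> cderive F t z -> cderive G t v ->
  cderive (fun s => F s / G s) t (z / G t - F t * v / G t ^+ 2).
Proof.
move=> G0 dF dG; have := cderive_mul dF (cderive_inv G0 dG).
by rewrite mulrA mulrN mulNr.
Qed.

Lemma cderive_line z v t : cderive (fun s => z + s%:C * v) t v.
Proof.
rewrite -[v in cderive _ _ v]add0r; apply: cderive_add; first exact: cderive_cst.
rewrite -[v in cderive _ _ v]mul1r -[_ * v]addr0.
rewrite -[X in _ + X](mulr0 t%:C); apply: cderive_mul; last exact: cderive_cst.
by split; [exact: is_derive_id | exact: is_derive_cst].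
Qed.

Lemma cderive_horner F (p : {poly R[i]}) t v : cderive F t v ->
  cderive (fun s => p.[F s]) t (v * p^`().[F t]).
Proof.
move=> dF; elim/poly_ind: p => [|p c ih].
  rewrite deriv0 horner0 mulr0.
  by apply: (cderive_ext _ (cderive_cst 0 t)) => s; rewrite horner0.
rewrite derivD derivM derivX derivC addr0 mulr1 hornerD hornerM hornerX.
apply: (@cderive_ext (fun s => p.[F s] * F s + c)) => [s|].
  by rewrite hornerD hornerM hornerX hornerC.
have := cderive_add (cderive_mul ih dF) (cderive_cst c t).
by congr (cderive _ _ _); ring.
Qed.

Lemma is_derive_ln_normc F t z : F t != 0 -> cderive F t z ->
  is_derive t 1 (fun s => ln (normc (F s))) (Re (z / F t)).
Proof.
move=> Ft0 [F1 F2]; have N0 := sqr_ReIm_neq0 Ft0.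
have Npos : 0 < Re (F t) * Re (F t) + Im (F t) * Im (F t).
  by rewrite lt_def N0 -!expr2 addr_ge0 ?sqr_ge0.
(* The identity is rewritten under the function, hence is needed at every [s]; at a zero of [F] both
   sides vanish because [ln 0] is 0. *)
have E s : ln (normc (F s)) = 2^-1 * ln (Re (F s) * Re (F s) + Im (F s) * Im (F s)).
  have -> : Re (F s) * Re (F s) + Im (F s) * Im (F s) = normc (F s) ^+ 2.
    case: (F s) => a b /=.
    by rewrite sqr_sqrtr ?addr_ge0 ?sqr_ge0 // !expr2.
  have [->|p] := eqVneq (F s) 0; first by rewrite normc0 expr0n /= ln0 ?mulr0.
  by rewrite lnXn ?normc_gt0 // mulr2n; field.
under eq_fun do rewrite E.
have dN := is_derive_add (is_derive_mul F1 F1) (is_derive_mul F2 F2).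
have dl := @is_derive1_comp R (@ln R)
  (fun s => Re (F s) * Re (F s) + Im (F s) * Im (F s)) t _ _ (is_derive1_ln Npos) dN.
apply: (is_derive_eq (is_derive_mul (is_derive_cst (2^-1 : R) t 1) dl)).
by rewrite /= mulr0 addr0 ReM Re_inv Im_inv; field.
Qed.

End complex_derivatives.

(** * Logarithmic jets *)

Section perturbed_fibonacci.
Variables (R : realType) (d : nat -> nat).
Hypotheses (d0_gt0 : (0 < d 0)%N) (d01 : (d 0 <= d 1)%N).
Hypothesis dSS : forall n, d n.+2 = (d n.+1 + d n)%N.
Implicit Types x e u : nat -> R[i].

(** [fib_gronwall] bounds the moduli. The weight [d n.+2] on [u n] serves the second conclusion: the
    defect contains $(x_{n+1}+x_n)u_n$, whose first factor may be as large as a multiple of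
    $d_{n+2}$. *)
Lemma fib_perturbed (B0 K : R) : 0 <= K -> exists2 B, 0 <= B & forall x e u,
  normc (x 0%N) <= B0 -> normc (x 1%N) <= B0 ->
  (forall n, x n.+2 = (x n.+1 + x n) * (1 - u n) + e n) ->
  (forall n, normc (u n) * (d n.+2)%:R <= K / 2 ^+ n) ->
  (forall n, normc (e n) <= K / 2 ^+ n) ->
  (forall n, normc (x n) <= B * (d n)%:R) /\
  (forall n, normc (x n.+2 - x n.+1 - x n) <= B).
Proof.
move=> K0; have [B hB] := fib_gronwall d0_gt0 d01 dSS B0 K0.
have bK n : K / 2 ^+ n <= K.
  by rewrite ler_pdivrMr ?exprn_gt0 // ler_peMr // exprn_ege1 // ler1n.
exists (`|B| + (`|B| * K + K)) => [|x e u x0 x1 xS uK eK].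
  by rewrite !addr_ge0 ?mulr_ge0.
have d1 n : 1 <= (d n)%:R :> R by rewrite ler1n fib_gt0.
have xB n : normc (x n) <= `|B| * (d n)%:R.
  apply: (@le_trans _ _ (B * (d n)%:R)); last first.
    by rewrite ler_wpM2r // ler_norm.
  apply: (hB (fun n => normc (x n))) => // m.
  rewrite xS; apply: le_trans (normc_addr_le _ _) _; apply: lerD => //.
  rewrite normcM ler_pM ?normc_ge0 ?normc_addr_le //.
  apply: le_trans (normc_addr_le _ _) _; rewrite normc1 normcN lerD2l.
  by apply: le_trans (uK m); rewrite ler_peMr ?normc_ge0.
split=> n.
  apply: le_trans (xB n) _; rewrite ler_wpM2r // lerDl addr_ge0 // mulr_ge0 //.
have -> : x n.+2 - x n.+1 - x n = - ((x n.+1 + x n) * u n) + e n.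
  by rewrite xS; ring.
apply: le_trans (normc_addr_le _ _) _; rewrite normcN normcM.
apply: (@le_trans _ _ (`|B| * K + K)); last by rewrite lerDr.
apply: lerD; last exact: le_trans (eK n) (bK n).
apply: (@le_trans _ _ (`|B| * (normc (u n) * (d n.+2)%:R))); last first.
  by rewrite ler_wpM2l // (le_trans (uK n)).
rewrite mulrCA [leRHS]mulrC ler_wpM2r ?normc_ge0 //.
apply: le_trans (normc_addr_le _ _) _.
by rewrite dSS natrD mulrDr lerD.
Qed.

(* The weight [d (n+2) ^ 3] absorbs the cubic term of the third recurrence. *)
Lemma fib_jets (B0 K : R) : 0 <= K -> exists B, forall x1 x2 x3 u,
  (forall j, (j < 2)%N ->
    [/\ normc (x1 j) <= B0, normc (x2 j) <= B0 & normc (x3 j) <= B0]) ->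
  (forall n, normc (u n) <= K / 16 ^+ n) ->
  (forall n, x1 n.+2 = (x1 n.+1 + x1 n) * (1 - u n)) ->
  (forall n, x2 n.+2 = (x2 n.+1 + x2 n) * (1 - u n)
     + (x1 n.+1 + x1 n) * u n * x1 n.+2) ->
  (forall n, x3 n.+2 = (x3 n.+1 + x3 n) * (1 - u n)
     + (2%:R * (x2 n.+1 + x2 n) * u n * x1 n.+2
        + (x1 n.+1 + x1 n) * (u n * x2 n.+2 - u n * x1 n.+2 ^+ 2))) ->
  forall n, [/\ normc (x1 n) <= B * (d n)%:R, normc (x2 n) <= B * (d n)%:R,
    normc (x3 n) <= B * (d n)%:R, normc (x1 n.+2 - x1 n.+1 - x1 n) <= B
    & normc (x2 n.+2 - x2 n.+1 - x2 n) <= B].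
Proof.
(* By [fib_le_expr2], $d_{n+2}^3\le(D2^{n+2})^3=64D^3 8^n$; against the decay $K/16^n$ this leaves
   $k/2^n$. *)
move=> K0; pose D : R := (d 1)%:R; pose k := 64 * D ^+ 3 * K.
have D1 : 1 <= D by rewrite ler1n fib_gt0.
have k0 : 0 <= k by rewrite !mulr_ge0 // exprn_ge0 // ler0n.
(* The constants are chained before any sequence is introduced: [B1] enters the error bound of the
   second recurrence, [B1] and [B2] that of the third. This keeps the final bound uniform. *)
have [B1 B10 H1] := fib_perturbed B0 k0.
have k20 : 0 <= k * (1 + B1 ^+ 2) by rewrite mulr_ge0 ?addr_ge0 ?exprn_ge0.
have [B2 B20 H2] := fib_perturbed B0 k20.
have k30 : 0 <= k * (1 + (3 * B2 * B1 + B1 ^+ 3)).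
  by rewrite mulr_ge0 ?addr_ge0 ?exprn_ge0 // !mulr_ge0.
have [B3 B30 H3] := fib_perturbed B0 k30.
exists (B1 + B2 + B3) => x1 x2 x3 u init uK r1 r2 r3.
have [i10 i20 i30] := init 0%N isT; have [i11 i21 i31] := init 1%N isT.
have E1 n : 1 <= (d n.+2)%:R :> R by rewrite ler1n fib_gt0.
have E0 n : 0 <= (d n)%:R :> R by [].
have w3 n : normc (u n) * (d n.+2)%:R ^+ 3 <= k / 2 ^+ n.
  have h1 : (d n.+2)%:R ^+ 3 <= (D * 2 ^+ n.+2) ^+ 3.
    have h0 : 0 <= D * 2 ^+ n.+2 by apply: mulr_ge0; rewrite ?exprn_ge0 ?ler0n.
    by apply: lerXn2r; rewrite ?nnegrE ?ler0n //; apply: fib_le_expr2.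
  apply: le_trans (ler_pM (normc_ge0 _) _ (uK n) h1) _; first exact: exprn_ge0.
  have e16 : 16 ^+ n = (2 ^+ n) ^+ 4 :> R.
    by rewrite exprAC; congr (_ ^+ n); ring.
  have : 2 ^+ n != 0 :> R by rewrite expf_neq0.
  rewrite e16 /k [2 ^+ n.+2]exprS [2 ^+ n.+1]exprS; move: (2 ^+ n) => a a0.
  by rewrite le_eqVlt; apply/orP; left; apply/eqP; field.
have w2 n : normc (u n) * (d n.+2)%:R ^+ 2 <= k / 2 ^+ n.
  apply: le_trans (w3 n); rewrite ler_wpM2l ?normc_ge0 //.
  by rewrite ler_weXn2l.
have w1 n : normc (u n) * (d n.+2)%:R <= k / 2 ^+ n.
  apply: le_trans (w2 n); rewrite ler_wpM2l ?normc_ge0 //.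
  by rewrite expr2 ler_peMl.
have kc (a : R) n : 0 <= a -> k / 2 ^+ n <= k * (1 + a) / 2 ^+ n.
  move=> a0; rewrite ler_wpM2r ?invr_ge0 ?exprn_ge0 //.
  by rewrite ler_peMr // lerDl.
have sumB (x : nat -> R[i]) (B : R) : (forall n, normc (x n) <= B * (d n)%:R) ->
    forall n, normc (x n.+1 + x n) <= B * (d n.+2)%:R.
  move=> xB n; apply: le_trans (normc_addr_le _ _) _.
  by rewrite dSS natrD mulrDr lerD.
have [b1 c1] : (forall n, normc (x1 n) <= B1 * (d n)%:R) /\
    (forall n, normc (x1 n.+2 - x1 n.+1 - x1 n) <= B1).
  apply: (H1 x1 (fun=> 0) u) => // n; first by rewrite addr0.
  by rewrite normc0 divr_ge0 ?exprn_ge0.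
have [b2 c2] : (forall n, normc (x2 n) <= B2 * (d n)%:R) /\
    (forall n, normc (x2 n.+2 - x2 n.+1 - x2 n) <= B2).
  apply: (H2 x2 (fun n => (x1 n.+1 + x1 n) * u n * x1 n.+2) u) => // n.
    by apply: le_trans (w1 n) _; apply: kc; exact: exprn_ge0.
  rewrite !normcM.
  apply: (@le_trans _ _ (B1 * (d n.+2)%:R * normc (u n) * (B1 * (d n.+2)%:R))).
    by rewrite !ler_pM ?mulr_ge0 ?normc_ge0 // sumB.
  rewrite (_ : _ * _ = B1 ^+ 2 * (normc (u n) * (d n.+2)%:R ^+ 2)); last by ring.
  apply: (@le_trans _ _ (B1 ^+ 2 * (k / 2 ^+ n))).
    by rewrite ler_wpM2l ?exprn_ge0.
  rewrite mulrA ler_wpM2r ?invr_ge0 ?exprn_ge0 // mulrC ler_wpM2l //.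
  by rewrite lerDr.
have [b3 _] : (forall n, normc (x3 n) <= B3 * (d n)%:R) /\
    (forall n, normc (x3 n.+2 - x3 n.+1 - x3 n) <= B3).
  apply: (H3 x3 (fun n => 2%:R * (x2 n.+1 + x2 n) * u n * x1 n.+2 +
    (x1 n.+1 + x1 n) * (u n * x2 n.+2 - u n * x1 n.+2 ^+ 2)) u) => // n.
    apply: le_trans (w1 n) _; apply: kc.
    by rewrite addr_ge0 ?exprn_ge0 // !mulr_ge0.
  set E : R := (d n.+2)%:R.
  apply: (@le_trans _ _ (3 * B2 * B1 * (normc (u n) * E ^+ 2)
                         + B1 ^+ 3 * (normc (u n) * E ^+ 3))).
    have s1 := sumB _ _ b1 n; have s2 := sumB _ _ b2 n.
    have t1 := b1 n.+2; have t2 := b2 n.+2; rewrite -/E in s1 s2 t1 t2.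
    have u0 := normc_ge0 (u n).
    have p1 : normc (2%:R * (x2 n.+1 + x2 n) * u n * x1 n.+2)
        <= 2 * (B2 * E) * normc (u n) * (B1 * E).
      have n2 : normc (2%:R : R[i]) = 2.
        by rewrite (normcMn (1 : R[i]) 2) normc1.
      by rewrite !normcM n2 !ler_pM ?mulr_ge0 ?normc_ge0.
    have p2 : normc ((x1 n.+1 + x1 n) * (u n * x2 n.+2 - u n * x1 n.+2 ^+ 2))
        <= B1 * E * (normc (u n) * (B2 * E) + normc (u n) * (B1 * E) ^+ 2).
      rewrite normcM ler_pM ?normc_ge0 //.
      apply: le_trans (normc_addr_le _ _) _; rewrite normcN [x1 n.+2 ^+ 2]expr2 !normcM.
      by rewrite [(B1 * E) ^+ 2]expr2 lerD // ler_wpM2l // ler_pM ?normc_ge0.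
    apply: le_trans (normc_addr_le _ _) _; apply: le_trans (lerD p1 p2) _.
    by rewrite le_eqVlt; apply/orP; left; apply/eqP; ring.
  apply: (@le_trans _ _ (3 * B2 * B1 * (k / 2 ^+ n) + B1 ^+ 3 * (k / 2 ^+ n))).
    by rewrite lerD // ler_wpM2l ?exprn_ge0 // !mulr_ge0.
  rewrite -mulrDl mulrA ler_wpM2r ?invr_ge0 ?exprn_ge0 // mulrC ler_wpM2l //.
  by rewrite lerDr.
move=> n; split.
- by apply: le_trans (b1 n) _; rewrite ler_wpM2r // -addrA lerDl addr_ge0.
- by apply: le_trans (b2 n) _; rewrite ler_wpM2r // addrAC lerDr addr_ge0.
- by apply: le_trans (b3 n) _; rewrite ler_wpM2r // lerDr addr_ge0.
- by apply: le_trans (c1 n) _; rewrite -addrA lerDl addr_ge0.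
- by apply: le_trans (c2 n) _; rewrite addrAC lerDr addr_ge0.
Qed.

Lemma fib_ratio_cvg_Re x (a : R[i]) (C : R) :
  (forall n, normc (x n.+2 - x n.+1 - x n) <= C) ->
  cvgn (fun n => Re (a * x n) / (d n)%:R).
Proof.
move=> xC; apply: (fib_ratio_cvg d0_gt0 d01 dSS (C := normc a * C)) => n.
have -> : Re (a * x n.+2) - Re (a * x n.+1) - Re (a * x n) =
    Re (a * (x n.+2 - x n.+1 - x n)).
  by rewrite !mulrBr; case: (a * x n.+2) (a * x n.+1) (a * x n) => ? ? [? ?] [? ?].
apply: le_trans (normr_Re_le _) _.
by rewrite normcM ler_wpM2l ?normc_ge0.
Qed.

End perturbed_fibonacci.

(* [a], [a1], [a2], [a3] stand for the values of a function and of its first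
   derivatives; [dlog1], [dlog2], [dlog3] are then the derivatives of its
   logarithm. *)
Section logarithmic_jets.
Variable F : fieldType.
Implicit Types a b c : F.

Definition dlog1 a a1 := a1 / a.
Definition dlog2 a a1 a2 := a2 / a - dlog1 a a1 * dlog1 a a1.
Definition dlog3 a a1 a2 a3 := a3 / a - 3%:R * (a2 / a * dlog1 a a1)
  + 2%:R * (dlog1 a a1 * dlog1 a a1 * dlog1 a a1).

(** The first line holds because $ab/e=1-u$. The other two are its successive derivatives, with
    $u'=-u\,e_1/e$. With free symbols in place of derivatives, all three are field identities. *)
Lemma dlog_recurrence a a1 a2 a3 b b1 b2 b3 c :
  a != 0 -> b != 0 -> a * b + c != 0 ->
  let e := a * b + c in
  let e1 := a1 * b + a * b1 in
  let e2 := a2 * b + a1 * b1 + (a1 * b1 + a * b2) in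
  let e3 := a3 * b + a2 * b1 + (a2 * b1 + a1 * b2)
            + (a2 * b1 + a1 * b2 + (a1 * b2 + a * b3)) in
  let u := c / e in
  [/\ dlog1 e e1 = (dlog1 a a1 + dlog1 b b1) * (1 - u),
      dlog2 e e1 e2 = (dlog2 a a1 a2 + dlog2 b b1 b2) * (1 - u)
        + (dlog1 a a1 + dlog1 b b1) * u * dlog1 e e1
    & dlog3 e e1 e2 e3 = (dlog3 a a1 a2 a3 + dlog3 b b1 b2 b3) * (1 - u)
        + (2%:R * (dlog2 a a1 a2 + dlog2 b b1 b2) * u * dlog1 e e1
           + (dlog1 a a1 + dlog1 b b1)
             * (u * dlog2 e e1 e2 - u * dlog1 e e1 ^+ 2))].
Proof.
rewrite /dlog3 /dlog2 /dlog1 => a0 b0 e0 /=.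
by split; field; rewrite ?a0 ?b0 ?e0.
Qed.

(** The left-hand side has the shape in which [cderive_div] returns the derivative along a line of
    direction [v]; likewise for [dlog3E]. *)
Lemma dlog2E a a1 a2 (v : F) : a != 0 ->
  v * a2 / a - a1 * (v * a1) / a ^+ 2 = v * dlog2 a a1 a2.
Proof. by move=> a0; rewrite /dlog2 /dlog1; field. Qed.

Lemma dlog3E a a1 a2 a3 (v : F) : a != 0 ->
  v * a3 / a - a2 * (v * a1) / a ^+ 2
    + (0 * (dlog1 a a1 * dlog1 a a1) + - 1 * (v * dlog2 a a1 a2 * dlog1 a a1
         + dlog1 a a1 * (v * dlog2 a a1 a2))) = v * dlog3 a a1 a2 a3.
Proof. by move=> a0; rewrite /dlog3 /dlog2 /dlog1; field. Qed.

End logarithmic_jets.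

(** * Logarithmic derivatives of polynomials along lines *)

Section logarithmic_derivatives.
Variable R : realType.
Implicit Types (p q : {poly R[i]}) (z v : R[i]).

Definition logd1 p z := dlog1 p.[z] p^`().[z].
Definition logd2 p z := dlog2 p.[z] p^`().[z] p^`()^`().[z].
Definition logd3 p z := dlog3 p.[z] p^`().[z] p^`()^`().[z] p^`()^`()^`().[z].

Lemma cderive_logd1 p z v (t : R) : p.[z + t%:C * v] != 0 ->
  cderive (fun s => logd1 p (z + s%:C * v)) t (v * logd2 p (z + t%:C * v)).
Proof.
move=> p0; have dl := cderive_line z v t.
have := cderive_div p0 (cderive_horner p^`() dl) (cderive_horner p dl).
by rewrite dlog2E.
Qed.

Lemma cderive_logd2 p z v (t : R) : p.[z + t%:C * v] != 0 ->
  cderive (fun s => logd2 p (z + s%:C * v)) t (v * logd3 p (z + t%:C * v)).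
Proof.
move=> p0; have dl := cderive_line z v t; have d1 := cderive_logd1 p0.
have d2 := cderive_div p0 (cderive_horner p^`()^`() dl) (cderive_horner p dl).
have dm := cderive_mul (cderive_cst (-1) t) (cderive_mul d1 d1).
have := cderive_add d2 dm; rewrite dlog3E // => h.
by apply: (cderive_ext _ h) => s; rewrite mulN1r.
Qed.

Lemma logd_recurrence p q (c z : R[i]) : p.[z] != 0 -> q.[z] != 0 ->
  (p * q + c%:P).[z] != 0 -> let e := p * q + c%:P in let u := c / e.[z] in
  [/\ logd1 e z = (logd1 p z + logd1 q z) * (1 - u),
      logd2 e z = (logd2 p z + logd2 q z) * (1 - u)
         + (logd1 p z + logd1 q z) * u * logd1 e z
    & logd3 e z = (logd3 p z + logd3 q z) * (1 - u)
         + (2%:R * (logd2 p z + logd2 q z) * u * logd1 e z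
            + (logd1 p z + logd1 q z) * (u * logd2 e z - u * logd1 e z ^+ 2))].
Proof.
rewrite /logd3 /logd2 /logd1 !(derivD, derivM, derivC, addr0).
by rewrite !(hornerD, hornerM, hornerC); exact: dlog_recurrence.
Qed.

End logarithmic_derivatives.

(** * The Green function *)

Section complex_topology.
Variable R : realType.
Implicit Types (z c : R[i]) (p : {poly R[i]}).

Lemma nbhs_normcP z (P : R[i] -> Prop) :
  (\forall w \near z, P w) <->
  exists2 r : R, 0 < r & forall w, normc (w - z) < r -> P w.
Proof.
split => [/nbhs_normP [e /= e0 H]|[r r0 H]].
  (* The radius of the ball is an element of [R[i]]; being positive, it is real. *)
  have eE : e = (Re e)%:C by rewrite RRe_real // ger0_real // ltW.
  exists (Re e) => [|w wz]; first by rewrite -ltcR -eE.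
  by apply: H; rewrite /= eE distrC ltc_norm.
apply/nbhs_normP; exists r%:C => /= [|w]; first by rewrite ltcR.
by rewrite /= distrC ltc_norm; exact: H.
Qed.

Lemma continuous_normc : continuous (@normc R).
Proof.
move=> z; apply/(@cvgrPdist_lt _ _ _ (nbhs z)) => e e0; apply/nbhs_normcP; exists e => // w wz.
rewrite ltr_norml; apply/andP; split.
  have := normc_addr_ge w (z - w); rewrite [w + _]addrC subrK -(normcN (z - w)) opprB.
  by move: wz; lra.
have := normc_addr_ge z (w - z); rewrite [z + _]addrC subrK.
by move: wz; lra.
Qed.

Lemma continuous_hornerc p : continuous (horner p : R[i] -> R[i]).
Proof.
elim/poly_ind: p => [|p c ih] z.
  rewrite (_ : horner 0 = fun=> 0); last by apply/funext => w; rewrite horner0.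
  exact: (@cvg_cst _ 0 _ (nbhs z)).
rewrite (_ : horner _ = fun w => p.[w] * w + c); last first.
  by apply/funext => w; rewrite !hornerE.
apply: (@cvgD _ _ _ (nbhs z)); last exact: (@cvg_cst _ c _ (nbhs z)).
apply: (@cvgM _ _ (nbhs z)); [exact: ih|exact: cvg_id].
Qed.

Lemma continuous_fseq (f : {poly R[i]}) n :
  continuous (fun x : R[i] * R[i] => (fseq f x.1 n).[x.2] : R[i]).
Proof.
elim/ltn_ind: n => -[|[|n]] ih x /=.
- by under eq_fun do rewrite hornerX; exact: cvg_snd.
- apply: (@cvg_comp _ _ _ (fun x : R[i] * R[i] => x.2) (horner f)); first exact: cvg_snd.
  exact: continuous_hornerc.
under eq_fun do rewrite hornerD hornerM hornerC.
apply: (@cvgD _ _ _ (nbhs x)); last exact: cvg_fst.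
by apply: (@cvgM _ _ (nbhs x)); [exact: (ih n.+1 _ x)|exact: (ih n _ x)].
Qed.

Lemma continuous_normc_fseq (f : {poly R[i]}) n :
  continuous (fun x : R[i] * R[i] => normc (fseq f x.1 n).[x.2]).
Proof.
move=> x; apply: (cvg_comp _ _ (@continuous_fseq f n x)).
exact: continuous_normc.
Qed.

(** In this form [ln] is evaluated only at points at least 1, where it is continuous and turns
    products into sums. *)
Lemma logpE (x : R) : 0 <= x -> logp x = ln (Num.max x 1).
Proof.
rewrite /logp => x0; have [x1|x1] := leP x 1.
  by rewrite ln1 max_r // ln_le0.
by rewrite max_l // ln_ge0 // ltW.
Qed.

Lemma logp_ge0 (x : R) : 0 <= logp x.
Proof. by rewrite /logp le_max lexx orbT. Qed.

Lemma logp_ln (x : R) : 1 <= x -> logp x = ln x.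
Proof. by move=> x1; rewrite /logp max_l // ln_ge0. Qed.

Lemma continuous_logp_normc_fseq (f : {poly R[i]}) n :
  continuous (fun x : R[i] * R[i] => logp (normc (fseq f x.1 n).[x.2])).
Proof.
move=> x; under eq_fun do rewrite logpE ?normc_ge0 //.
have c1 : {for x, continuous (fun=> 1 : R)} by exact: (@cvg_cst _ (1 : R) _ (nbhs x)).
have cm := continuous_max (@continuous_normc_fseq f n x) c1.
apply: (continuous_comp cm); apply: continuous_ln.
by rewrite lt_max ltr01 orbT.
Qed.

(* [1 + k] bounds [(xy + k) / (max(x,1) max(y,1))]. *)
Lemma logp_submul (k x y t : R) : 0 <= k -> 0 <= x -> 0 <= y -> 0 <= t ->
  t <= x * y + k -> logp t <= logp x + logp y + ln (1 + k).
Proof.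
move=> k0 x0 y0 t0 h; rewrite !logpE //.
have X1 : 1 <= Num.max x 1 by rewrite le_max lexx orbT.
have Y1 : 1 <= Num.max y 1 by rewrite le_max lexx orbT.
have Xx : x <= Num.max x 1 by rewrite le_max lexx.
have Yy : y <= Num.max y 1 by rewrite le_max lexx.
have T0 : 0 < Num.max t 1 by rewrite lt_max ltr01 orbT.
move: X1 Y1 Xx Yy; set X := Num.max x 1; set Y := Num.max y 1 => X1 Y1 Xx Yy.
have X0 : 0 < X by apply: lt_le_trans X1.
have Y0 : 0 < Y by apply: lt_le_trans Y1.
have k1 : 0 < 1 + k by rewrite ltr_pwDl.
rewrite -!lnM ?posrE ?mulr_gt0 // ler_ln ?posrE ?mulr_gt0 //.
have XY1 : 1 <= X * Y by rewrite mulr_ege1.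
have xy := ler_pM x0 y0 Xx Yy; have kXY := ler_peMl k0 XY1.
rewrite ge_max mulrDr mulr1; apply/andP; split.
  by apply: le_trans h _; rewrite lerD.
apply: le_trans XY1 _; rewrite lerDl; apply: mulr_ge0 => //; exact/ltW/mulr_gt0.
Qed.

End complex_topology.

(** * Degrees of the iterates *)

Section degrees.
Variables (R : realType) (f : {poly R[i]}).
Hypothesis hf : (1 <= (size f).-1)%N.

(** The two claims need each other: factors that are not constant have a product that is not
    constant, so adding the constant [c] leaves its degree unchanged. *)
Lemma size_fseq_gt1 c n : (1 < size (fseq f c n))%N /\
  size (fseq f c n.+2) = (size (fseq f c n.+1) + size (fseq f c n)).-1.
Proof.
have gt1D (a b : nat) : (1 < a)%N -> (1 < b)%N -> (1 < (a + b).-1)%N.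
  by case: a => [|[|a]] //; case: b => [|[|b]] // _ _; rewrite !addnS.
have step m : (1 < size (fseq f c m))%N -> (1 < size (fseq f c m.+1))%N ->
    size (fseq f c m.+2) = (size (fseq f c m.+1) + size (fseq f c m)).-1.
  move=> s0 s1; rewrite /= -/(fseq f c m.+1).
  have e : size (fseq f c m.+1 * fseq f c m) =
      (size (fseq f c m.+1) + size (fseq f c m)).-1.
    by rewrite size_mul // -size_poly_gt0 ltnW.
  rewrite size_polyDl -?e // e; apply: leq_ltn_trans (size_polyC_leq1 c) _.
  exact: gt1D.
have gt1 m : (1 < size (fseq f c m))%N /\ (1 < size (fseq f c m.+1))%N.
  elim: m => [|m [i0 i1]].
    by rewrite /= size_polyX; split => //; move: hf; case: (size f) => [|[|]].
  by split=> //; rewrite step //; exact: gt1D.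
by have [g0 g1] := gt1 n; split => //; exact: step.
Qed.

Lemma dseqSS c n : dseq f c n.+2 = (dseq f c n.+1 + dseq f c n)%N.
Proof.
have [s0 sS] := size_fseq_gt1 c n; have [s1 _] := size_fseq_gt1 c n.+1.
rewrite /dseq sS; case: (size _) s1 => [|a] // _.
by case: (size _) s0 => [|b] // _; rewrite addnS.
Qed.

Lemma dseq0 c : dseq f c 0 = 1%N.
Proof. by rewrite /dseq /= size_polyX. Qed.

Lemma dseq1 c : dseq f c 1 = (size f).-1.
Proof. by []. Qed.

Lemma dseq_gt0 c n : (0 < dseq f c n)%N.
Proof. by have [] := size_fseq_gt1 c n; rewrite /dseq; case: (size _) => [|[|]]. Qed.

Lemma dseq_le c n : (dseq f c n <= dseq f c n.+1)%N.
Proof. by case: n => [|n]; rewrite ?dseq0 ?dseq1 // dseqSS leq_addr. Qed.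

(** In the proof of joint continuity this freezes the degrees at [c0] while [c] varies. *)
Lemma dseq_indep c c' n : dseq f c n = dseq f c' n.
Proof.
by elim/ltn_ind: n => -[|[|n]] ih //; rewrite !dseqSS !ih.
Qed.

Lemma dseq_natr_gt0 c n : 0 < (dseq f c n)%:R :> R.
Proof. by rewrite ltr0n dseq_gt0. Qed.

Lemma dseq_cvgy c : (dseq f c n)%:R^-1 @[n --> \oo] --> (0 : R).
Proof. by apply: fib_cvgy; [exact: dseq_gt0|exact: dseq_le|exact: dseqSS]. Qed.

End degrees.

(** * Existence of the limit, its zero set and its joint continuity *)

Section green_function.
Variables (R : realType) (f : {poly R[i]}).
Hypothesis hf : (1 <= (size f).-1)%N.
Implicit Types (c z : R[i]).

Local Notation W c z n := (fseq f c n).[z].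
Local Notation m c z n := (normc (fseq f c n).[z]).
Local Notation d c n := (dseq f c n).

Lemma fseqSS c z n : W c z n.+2 = W c z n.+1 * W c z n + c.
Proof. by rewrite /= -/(fseq f c n.+1) hornerD hornerM hornerC. Qed.

Lemma normc_fseq_le c z n : m c z n.+2 <= m c z n.+1 * m c z n + normc c.
Proof. by rewrite fseqSS -normcM normc_addr_le. Qed.

Lemma normc_fseq_ge c z n : m c z n.+1 * m c z n - normc c <= m c z n.+2.
Proof. by rewrite fseqSS -normcM normc_addr_ge. Qed.

Definition escapes c z N :=
  32 + 2 * normc c <= m c z N /\ 32 + 2 * normc c <= m c z N.+1.

Section escaping_orbit.
Variables (c z : R[i]) (N : nat).
Hypothesis esc : escapes c z N.

Let hle n := normc_fseq_le c z (n + N).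
Let hge n := normc_fseq_ge c z (n + N).

Lemma escapes_shift n : escapes c z (n + N).
Proof.
have h := escape_ge (m := fun n => m c z (n + N)) (normc_ge0 c) hge (proj1 esc) (proj2 esc).
by split; [exact: h n | exact: h n.+1].
Qed.

Lemma escapes_ge32 n : 32 <= m c z (n + N).
Proof.
have [h _] := escapes_shift n; apply: le_trans h.
by rewrite lerDl mulr_ge0 // normc_ge0.
Qed.

Lemma escapes_gt0 n : 0 < m c z (n + N).
Proof. by apply: lt_le_trans (escapes_ge32 n). Qed.

Lemma escapes_mono (T : R) : T <= m c z N -> T <= m c z N.+1 ->
  forall n, T <= m c z (n + N).
Proof.
exact: (escape_ge_mono (m := fun n => m c z (n + N)) (normc_ge0 c) hge
  (proj1 esc) (proj2 esc)).
Qed.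

Lemma escapes_growth n : 16 ^+ n <= m c z (n + N).
Proof.
exact: (escape_growth (m := fun n => m c z (n + N)) (normc_ge0 c) hge
  (proj1 esc) (proj2 esc)).
Qed.

Lemma escapes_notK : (~` Kset f c) z.
Proof.
move=> [B hB].
have [n Bn] : exists n, B < n%:R :> R.
  exists (Num.truncn `|B|).+1; apply: le_lt_trans (ler_norm B) _.
  exact: truncnS_gt.
have : m c z (n + N) <= B by apply: hB; exists (n + N)%N.
apply/negP; rewrite -ltNge; apply: lt_le_trans Bn _.
apply: le_trans (escapes_growth n).
by rewrite -natrX ler_nat ltnW // ltn_expl.
Qed.

Lemma green_seq_escapes n :
  green_seq f c z (n + N) = ln (m c z (n + N)) / (d c (n + N))%:R.
Proof.
rewrite /green_seq mulrC logp_ln //.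
by apply: le_trans (escapes_ge32 n); rewrite ler1n.
Qed.

(** Beyond [N] the positive part of the logarithm is the logarithm itself, whose defect is at most
    [ln 2]. The shifted degrees are still Fibonacci-like, so [fib_ratio_cvg] applies. *)
Lemma green_escapes_cvg :
  ln (m c z (n + N)) / (d c (n + N))%:R @[n --> \oo] --> green f c z.
Proof.
have cv : cvgn (fun n => ln (m c z (n + N)) / (d c (n + N))%:R).
  apply: (fib_ratio_cvg (d := fun n => d c (n + N)) _ _ _ (C := ln 2)).
  - exact: dseq_gt0.
  - exact: dseq_le.
  - by move=> n; exact: dseqSS.
  - exact: (escape_ln_defect (m := fun n => m c z (n + N)) (normc_ge0 c) hle hge
      (proj1 esc) (proj2 esc)).
have cv2 : green_seq f c z n @[n --> \oo] -->
    limn (fun n => ln (m c z (n + N)) / (d c (n + N))%:R).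
  rewrite -(cvg_shiftn N); apply: cvg_trans cv.
  by apply: near_eq_cvg; apply: nearW => n; rewrite /= green_seq_escapes.
by rewrite /green (cvg_lim _ cv2).
Qed.

Lemma green_seq_cvg_escapes : cvgn (green_seq f c z).
Proof.
apply/cvg_ex; exists (green f c z); rewrite -(cvg_shiftn N).
apply: cvg_trans green_escapes_cvg.
by apply: near_eq_cvg; apply: nearW => n; rewrite /= green_seq_escapes.
Qed.

(** Lower half of the continuity sandwich: two consecutive terms control the limit from below, by
    superadditivity of [ln (m / 2)]. *)
Lemma green_ge_escapes (e : R) :
  e * (d c N)%:R <= ln (m c z N / 2) -> e * (d c N.+1)%:R <= ln (m c z N.+1 / 2) ->
  e <= green f c z.
Proof.
move=> e0 e1; apply: (cvgr_to_ge green_escapes_cvg); apply: nearW => n.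
rewrite ler_pdivlMr ?dseq_natr_gt0 //.
apply: le_trans (_ : ln (m c z (n + N) / 2) <= _); last first.
  have p := escapes_gt0 n.
  by rewrite ler_ln ?posrE ?divr_gt0 // ler_pdivrMr // ler_peMr ?ler1n // ltW.
apply: (fib_superadditive_ge (d := fun n => d c (n + N)) _
  (x := fun n => ln (m c z (n + N) / 2))) => // j; first exact: dseqSS.
exact: (escape_ln_lower (m := fun n => m c z (n + N)) (normc_ge0 c) hge
  (proj1 esc) (proj2 esc)).
Qed.

Lemma green_gt0_escapes : 0 < green f c z.
Proof.
have l0 n : 0 < ln (m c z (n + N) / 2).
  by apply: ln_gt0; have := escapes_ge32 n; lra.
pose e : R := Num.min (ln (m c z N / 2) / (d c N)%:R) (ln (m c z N.+1 / 2) / (d c N.+1)%:R).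
have e0 : 0 < e.
  rewrite lt_min; apply/andP; split; apply: divr_gt0 (dseq_natr_gt0 hf _ _).
    exact: (l0 0%N).
  exact: (l0 1%N).
apply: lt_le_trans e0 _; apply: green_ge_escapes.
  by rewrite -ler_pdivlMr ?dseq_natr_gt0 // ge_min lexx.
by rewrite -ler_pdivlMr ?dseq_natr_gt0 // ge_min lexx orbT.
Qed.

End escaping_orbit.

(** The level [T] is left free so that it can be taken above the escape threshold; the margin makes
    escape stable under small changes of [c] and [z]. *)
Lemma notK_large c z (T : R) : (~` Kset f c) z ->
  exists n, T <= m c z n /\ T <= m c z n.+1.
Proof.
move=> nK; apply: (exists_large_pair (m := fun n => m c z n) (k := normc c)) => //.
- by move=> n; exact: normc_ge0.
- exact: normc_ge0.
- exact: normc_fseq_le.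
- exact: normc_fseq_ge.
Qed.

Lemma notK_escapes c z : (~` Kset f c) z -> exists N, escapes c z N.
Proof. exact: notK_large. Qed.

Lemma green_seq_cvg_K c z : Kset f c z -> green_seq f c z n @[n --> \oo] --> (0 : R).
Proof.
move=> [B hB]; pose A : R := logp (Num.max B 1).
have mA n : logp (m c z n) <= A.
  have B1 : 1 <= Num.max B 1 by rewrite le_max lexx orbT.
  rewrite /A (logp_ln B1) logpE ?normc_ge0 //.
  rewrite ler_ln ?posrE ?lt_max ?ltr01 ?orbT // ge_max !le_max lexx orbT andbT.
  by rewrite (hB (m c z n)) //; exists n.
apply: (@squeeze_cvgr _ _ _ _ (fun=> 0) (fun n => (d c n)%:R^-1 * A)).
- apply: nearW => n; rewrite /green_seq mulr_ge0 ?logp_ge0 ?invr_ge0 ?ler0n //=.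
  by rewrite ler_wpM2l ?invr_ge0.
- exact: cvg_cst.
- rewrite -(mul0r A); apply: cvgM; last exact: cvg_cst.
  exact: dseq_cvgy.
Qed.

Lemma green_seq_cvg c z : cvgn (green_seq f c z).
Proof.
case: (pselect (Kset f c z)) => [Kz|/notK_escapes [N esc]].
  by apply/cvg_ex; exists 0; exact: green_seq_cvg_K.
exact: green_seq_cvg_escapes esc.
Qed.

Lemma green_ge0 c z : 0 <= green f c z.
Proof.
apply: limr_ge; first exact: green_seq_cvg.
by apply: nearW => n; rewrite /green_seq mulr_ge0 ?logp_ge0 ?invr_ge0.
Qed.

Lemma Kset_green c : Kset f c = green f c @^-1` [set 0].
Proof.
apply/seteqP; split => z /= Kz; first by apply: cvg_lim (green_seq_cvg_K Kz).
apply: contrapT => /notK_escapes [N /green_gt0_escapes].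
by rewrite Kz ltxx.
Qed.

(** Upper half of the sandwich, valid for bounded orbits as well. The bound [k] replaces [normc c]
    so that one constant serves a whole neighbourhood. *)
Lemma green_le c z (k e : R) n : normc c <= k ->
  logp (m c z n) + ln (1 + k) <= e * (d c n)%:R ->
  logp (m c z n.+1) + ln (1 + k) <= e * (d c n.+1)%:R -> green f c z <= e.
Proof.
move=> ck e0 e1; have k0 : 0 <= k by apply: le_trans (normc_ge0 c) ck.
have l0 : 0 <= ln (1 + k) by rewrite ln_ge0 // lerDl.
have cv : green_seq f c z (j + n) @[j --> \oo] --> green f c z.
  by rewrite (cvg_shiftn n); exact: green_seq_cvg.
apply: (cvgr_to_le cv); apply: nearW => j.
rewrite /green_seq ler_pdivrMl ?dseq_natr_gt0 // mulrC.
apply: (@le_trans _ _ (logp (m c z (j + n)) + ln (1 + k))).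
  by rewrite lerDl.
apply: (fib_subadditive_le (d := fun j => d c (j + n)) _
  (x := fun j => logp (m c z (j + n)) + ln (1 + k))) => // i.
  exact: dseqSS.
rewrite addrACA addrA lerD2r; apply: logp_submul; rewrite ?normc_ge0 //.
by apply: le_trans (normc_fseq_le _ _ _) _; rewrite lerD2l.
Qed.

Lemma green_continuous : continuous (fun x : R[i] * R[i] => green f x.1 x.2).
Proof.
move=> [c0 z0]; apply/cvgrPdist_lt => e e0 /=.
have upper : \forall x \near (c0, z0), green f x.1 x.2 < green f c0 z0 + e.
  (* [k] bounds [normc c] for [c] near [c0]. The term [ln (1 + k)] that [green_le] requires
     disappears in the limit after division by the degree. *)
  pose k : R := normc c0 + 1; pose a n := (logp (m c0 z0 n) + ln (1 + k)) / (d c0 n)%:R.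
  have ca : a n @[n --> \oo] --> green f c0 z0.
    rewrite -[green f c0 z0]addr0 -(mulr0 (ln (1 + k))).
    under eq_fun do rewrite /a mulrDl [logp _ / _]mulrC.
    apply: cvgD; first exact: green_seq_cvg.
    by apply: cvgM; [exact: cvg_cst|exact: dseq_cvgy].
  have gE : green f c0 z0 < green f c0 z0 + e / 2 by rewrite ltrDl divr_gt0.
  have [N _ aN] := cvgr_lt _ ca _ gE.
  have near_le n : (N <= n)%N -> \forall x \near (c0, z0),
      logp (m x.1 x.2 n) + ln (1 + k) <= (green f c0 z0 + e / 2) * (d x.1 n)%:R.
    move=> Nn; have := aN n Nn; rewrite /= /a ltr_pdivrMr ?dseq_natr_gt0 // => h.
    have cl : logp (m x.1 x.2 n) + ln (1 + k) @[x --> (c0, z0)] -->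
        logp (m c0 z0 n) + ln (1 + k).
      by apply: cvgD; [exact: (@continuous_logp_normc_fseq R f n (c0, z0))|exact: cvg_cst].
    apply: filterS (cvgr_lt _ cl _ h) => x /ltW.
    by rewrite (dseq_indep hf x.1 c0).
  have ck : \forall x \near (c0, z0), normc x.1 <= k.
    have cn : normc x.1 @[x --> (c0, z0)] --> normc c0.
      apply: (@cvg_comp _ _ _ (fun x : R[i] * R[i] => x.1) (@normc R)).
        exact: cvg_fst.
      exact: continuous_normc.
    by apply: (cvgr_le _ cn); rewrite /k ltrDl.
  near=> x; apply: (@le_lt_trans _ _ (green f c0 z0 + e / 2)); last first.
    by rewrite ltrD2l gtr_pMr // invf_lt1 // ltr1n.
  apply: (@green_le _ _ k _ N); near: x; first exact: ck.
    exact: near_le.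
  exact: near_le.
have lower : \forall x \near (c0, z0), green f c0 z0 - e < green f x.1 x.2.
  (* If $g_{c_0}(z_0)<e$, nonnegativity gives the lower bound at once; otherwise $g_{c_0}(z_0)>0$
     and the orbit escapes. *)
  have [ge|eg] := ltP (green f c0 z0) e.
    apply: (@nearW _ (nbhs (c0, z0))) => x.
    by apply: lt_le_trans (green_ge0 _ _); rewrite subr_lt0.
  have nK : (~` Kset f c0) z0.
    rewrite Kset_green /= => g0; move: eg; rewrite g0; apply/negP.
    by rewrite -ltNge.
  (* The value [65 / 2 + 2 * normc c0] will separate: nearby moduli stay above it, by the margin 33,
     while the nearby threshold [32 + 2 * normc c] stays below it. *)
  have [N [N0 N1]] := notK_large (33 + 2 * normc c0) nK.
  have esc : escapes c0 z0 N.
    by split; [apply: le_trans N0|apply: le_trans N1]; rewrite lerD2r ler_nat.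
  have ca : (ln (m c0 z0 (n + N) / 2)) / (d c0 (n + N))%:R @[n --> \oo] -->
      green f c0 z0.
    rewrite -[green f c0 z0]subr0 -(mulr0 (ln 2)).
    have E n : ln (m c0 z0 (n + N) / 2) / (d c0 (n + N))%:R =
        ln (m c0 z0 (n + N)) / (d c0 (n + N))%:R - ln 2 * (d c0 (n + N))%:R^-1.
      have p := escapes_gt0 esc n.
      by rewrite ln_div ?posrE // mulrBl.
    under eq_fun do rewrite E.
    apply: cvgB; first exact: green_escapes_cvg.
    apply: cvgM; first exact: cvg_cst.
    by rewrite (cvg_shiftn N (fun n => (d c0 n)%:R^-1 : R)); exact: dseq_cvgy.
  have gE : green f c0 z0 - e / 2 < green f c0 z0 by rewrite ltrBlDr ltrDl divr_gt0.
  have [M _ aM] := cvgr_gt _ ca _ gE.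
  have cn : 32 + 2 * normc x.1 @[x --> (c0, z0)] --> 32 + 2 * normc c0.
    apply: cvgD; first exact: cvg_cst.
    apply: cvgM; first exact: cvg_cst.
    apply: (@cvg_comp _ _ _ (fun x : R[i] * R[i] => x.1) (@normc R)).
      exact: cvg_fst.
    exact: continuous_normc.
  have ckT : \forall x \near (c0, z0), 32 + 2 * normc x.1 < 65 / 2 + 2 * normc c0.
    by apply: (cvgr_lt _ cn); rewrite ltrD2r; lra.
  have near_ge n : (M <= n)%N -> \forall x \near (c0, z0),
      (green f c0 z0 - e / 2) * (d x.1 (n + N))%:R <= ln (m x.1 x.2 (n + N) / 2) /\
      65 / 2 + 2 * normc c0 < m x.1 x.2 (n + N).
    move=> Mn; have := aM n Mn; rewrite /= ltr_pdivlMr ?dseq_natr_gt0 // => h.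
    have p := escapes_gt0 esc n.
    have cl : ln (m x.1 x.2 (n + N) / 2) @[x --> (c0, z0)] -->
        ln (m c0 z0 (n + N) / 2).
      apply: (@cvg_comp _ _ _ (fun x : R[i] * R[i] => m x.1 x.2 (n + N) / 2) (@ln R)).
        by apply: cvgM; [exact: (@continuous_normc_fseq R f (n + N) (c0, z0))|exact: cvg_cst].
      by apply: continuous_ln; rewrite divr_gt0.
    have big : 65 / 2 + 2 * normc c0 < m c0 z0 (n + N).
      apply: lt_le_trans (escapes_mono esc N0 N1 n).
      by rewrite ltrD2r; lra.
    near=> x; split.
      rewrite (dseq_indep hf x.1 c0); apply: ltW; near: x; exact: (cvgr_gt _ cl _ h).
    near: x; exact: (cvgr_gt _ (@continuous_normc_fseq _ f (n + N) (c0, z0)) _ big).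
  near=> x.
  have [h0 b0] :
      (green f c0 z0 - e / 2) * (d x.1 (M + N))%:R <= ln (m x.1 x.2 (M + N) / 2) /\
      65 / 2 + 2 * normc c0 < m x.1 x.2 (M + N).
    by near: x; exact: near_ge.
  have [h1 b1] :
      (green f c0 z0 - e / 2) * (d x.1 (M.+1 + N))%:R
        <= ln (m x.1 x.2 (M.+1 + N) / 2) /\
      65 / 2 + 2 * normc c0 < m x.1 x.2 (M.+1 + N).
    by near: x; exact: near_ge.
  have kx : 32 + 2 * normc x.1 < 65 / 2 + 2 * normc c0 by near: x; exact: ckT.
  apply: (@lt_le_trans _ _ (green f c0 z0 - e / 2)).
    by rewrite ltrD2l ltrN2 gtr_pMr // invf_lt1 // ltr1n.
  apply: (@green_ge_escapes _ _ (M + N)) => //.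
  by split; apply: ltW; [apply: lt_trans kx b0|apply: lt_trans kx b1].
near=> x.
rewrite ltr_distlC; apply/andP; split; near: x.
  exact: lower.
exact: upper.
Unshelve. all: by end_near. Qed.

End green_function.

(** * Behaviour at infinity *)

Section asymptotics.
Variables (R : realType) (f : {poly R[i]}).
Hypothesis hf : (1 <= (size f).-1)%N.
Implicit Types (c z : R[i]).

Lemma lead_coef_fneq0 : lead_coef f != 0.
Proof. by rewrite lead_coef_eq0 -size_poly_eq0; case: (size f) hf. Qed.

(** Factor out the leading term. The first bound makes $f(z)$ large, so that the orbit escapes from
    index 0; the second is the initial value for the error recurrence in [green_near_infty]. *)
Lemma ln_normc_horner_near_infty (e : R) : 0 < e -> exists2 M : R, 1 <= M &
  forall z, M < normc z ->
    normc (lead_coef f) / 2 * normc z <= normc f.[z] /\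
    `|ln (normc f.[z]) - (size f).-1%:R * ln (normc z) - ln (normc (lead_coef f))|
      <= e.
Proof.
move=> e0; set a := lead_coef f; set D := (size f).-1.
have a0 : 0 < normc a by rewrite normc_gt0 lead_coef_fneq0.
pose A : R := \sum_(i < D) normc f`_i.
have A0 : 0 <= A by apply: sumr_ge0 => i _; exact: normc_ge0.
(* The summand 1 lets every lower power of $|z|$ be bounded by the power $D-1$; the two fractions
   ensure $|x|\le\frac12$ and $2|x|\le e$ for the relative remainder [x] below. *)
exists (1 + (2 * A / normc a + 2 * A / (normc a * e))).
  by rewrite lerDl addr_ge0 // divr_ge0 ?mulr_ge0 // ltW // ltW.
move=> z; set Z := normc z => MZ.
have p1 : 0 <= 2 * A / normc a by rewrite divr_ge0 ?mulr_ge0 // ltW.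
have p2 : 0 <= 2 * A / (normc a * e) by rewrite divr_ge0 ?mulr_ge0 // ltW // mulr_gt0.
have Z1 : 1 < Z by apply: le_lt_trans MZ; rewrite lerDl addr_ge0.
have Z0 : 0 < Z by apply: lt_trans Z1.
have z0 : z != 0 by rewrite -normc_gt0.
have D1 : D = D.-1.+1 by rewrite prednK.
pose x := (\sum_(i < D) f`_i * z ^+ i) / (a * z ^+ D).
have azD : a * z ^+ D != 0 by rewrite mulf_neq0 ?expf_neq0 // lead_coef_fneq0.
have fE : f.[z] = a * z ^+ D * (1 + x).
  have xE : a * z ^+ D * x = \sum_(i < D) f`_i * z ^+ i.
    by rewrite mulrC divfK.
  rewrite mulrDr mulr1 xE horner_coef -[a]/(f`_D).
  have -> : size f = D.+1 by rewrite /D prednK //; case: (size f) hf.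
  by rewrite big_ord_recr /= addrC.
have xle : normc x <= A / (normc a * Z).
  rewrite /x normcM normcV normcM normcX -/Z.
  rewrite ler_pdivrMr; last by rewrite mulr_gt0 // exprn_gt0.
  have ZD : Z ^+ D = Z * Z ^+ D.-1 by rewrite {1}D1 exprS.
  have -> : A / (normc a * Z) * (normc a * Z ^+ D) = A * Z ^+ D.-1.
    by rewrite ZD; field; rewrite !gt_eqF.
  rewrite /A mulr_suml; apply: le_trans (normc_sum _ _ _) _.
  apply: ler_sum => i _; rewrite normcM normcX ler_wpM2l ?normc_ge0 //.
  by rewrite ler_weXn2l ?ltW // -ltnS -D1.
have x2 : normc x <= 1 / 2.
  apply: le_trans xle _; rewrite ler_pdivrMr ?mulr_gt0 //.
  have : 2 * A / normc a <= Z by apply/ltW; apply: le_lt_trans MZ; lra.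
  by rewrite ler_pdivrMr // => ?; lra.
have xe : 2 * normc x <= e.
  have : 2 * A / (normc a * e) <= Z by apply/ltW; apply: le_lt_trans MZ; lra.
  rewrite ler_pdivrMr ?mulr_gt0 // => h.
  apply: (@le_trans _ _ (2 * (A / (normc a * Z)))); first by rewrite ler_wpM2l.
  by rewrite mulrA ler_pdivrMr ?mulr_gt0 //; lra.
have x1 : 1 / 2 <= normc (1 + x).
  by have := normc_addr_ge 1 x; rewrite normc1; lra.
have x10 : 0 < normc (1 + x) by apply: lt_le_trans x1; lra.
split.
  rewrite fE !normcM normcX -/Z.
  have ZD : Z <= Z ^+ D by rewrite D1 exprS ler_peMr ?(ltW Z0) // exprn_ege1 // ltW.
  apply: (@le_trans _ _ (normc a * Z ^+ D * (1 / 2))).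
    rewrite -!mulrA ler_wpM2l ?(ltW a0) // mulrC div1r ler_wpM2r //.
  by rewrite ler_wpM2l // mulr_ge0 ?exprn_ge0 // ltW.
rewrite fE !normcM normcX -/Z !lnM ?posrE ?mulr_gt0 ?exprn_gt0 //.
rewrite lnXn // -[ln Z *+ D]mulr_natl.
rewrite (_ : _ - _ - _ = ln (normc (1 + x))); last by ring.
exact: le_trans (ln_normc1D x2) xe.
Qed.

Local Notation W c z n := (fseq f c n).[z].
Local Notation m c z n := (normc (fseq f c n).[z]).
Local Notation d c n := (dseq f c n).
Local Notation s c := (series (fun n : nat =>
  (-1) ^+ n / ((d c n)%:R * (d c n.+1)%:R) : R)).

(* [d n * s n] is the solution of the Fibonacci recurrence starting from 0, 1. *)
Lemma dseq_series_recurrence c n :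
  (d c n.+2)%:R * s c n.+2 = (d c n.+1)%:R * s c n.+1 + (d c n)%:R * s c n.
Proof.
have sS k : s c k.+1 = s c k + (-1) ^+ k / ((d c k)%:R * (d c k.+1)%:R).
  by rewrite /series /= big_nat_recr.
have g k : (d c k)%:R != 0 :> R by rewrite gt_eqF // dseq_natr_gt0.
have g2 := g n.+2; have gn := g n; have g1 := g n.+1.
rewrite !sS exprS; move: (s c n) ((-1) ^+ n) => x y.
by rewrite !dseqSS // natrD in g2 *; field; rewrite gn g1 g2.
Qed.

(** The products $d_ns_n$ satisfy the Fibonacci recurrence with no defect, so [fib_ratio_cvg]
    applies with [C = 0]. *)
Lemma series_dseq_cvg c : cvgn (s c).
Proof.
have := fib_ratio_cvg (dseq_gt0 hf c 0) (dseq_le hf c 0) (dseqSS hf c)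
  (x := fun n => (d c n)%:R * s c n) (C := 0).
rewrite (_ : (fun n => (d c n)%:R * s c n / (d c n)%:R) = s c); last first.
  by apply/funext => n; rewrite [LHS]mulrC mulKf // gt_eqF // dseq_natr_gt0.
by apply => n; rewrite dseq_series_recurrence addrAC addrK subrr normr0.
Qed.

Lemma ln_normc_fseqSS c z n : W c z n != 0 -> W c z n.+1 != 0 ->
  W c z n.+2 != 0 ->
  ln (m c z n.+2) = ln (m c z n.+1) + ln (m c z n)
    + ln (normc (1 + c / (W c z n.+1 * W c z n))).
Proof.
move=> W0 W1 W2.
have E : W c z n.+2 = W c z n.+1 * W c z n * (1 + c / (W c z n.+1 * W c z n)).
  by rewrite fseqSS; field; rewrite W0 W1.
have : 1 + c / (W c z n.+1 * W c z n) != 0.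
  by apply: contraNneq W2 => h; rewrite E h mulr0.
by move=> h; rewrite E !normcM !lnM ?posrE ?mulr_gt0 ?normc_gt0.
Qed.

Lemma green_near_infty c (e : R) : 0 < e -> exists M : R, forall z, M < normc z ->
  `|green f c z - ln (normc z) - ln (normc (lead_coef f)) * limn (s c)| < e.
Proof.
move=> e0; pose h : R := e / 3; have h0 : 0 < h by rewrite divr_gt0.
have [M M1 HM] := ln_normc_horner_near_infty h0.
(* The last summand gives $2|c|/T\le h$, which bounds the defect $\ln|1+c/(f_{n+1}f_n)|$ at every
   index. *)
pose T : R := 32 + 2 * normc c + 2 * normc c / h.
have c0 := normc_ge0 c.
have q0 : 0 <= 2 * normc c / h by rewrite divr_ge0 ?mulr_ge0 // ltW.
have T32 : 32 + 2 * normc c <= T by rewrite /T lerDl.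
have T0 : 0 < T by apply: lt_le_trans T32; lra.
have a0 : 0 < normc (lead_coef f) by rewrite normc_gt0 lead_coef_fneq0.
exists (Num.max M (Num.max T (2 * T / normc (lead_coef f)))) => z.
rewrite !gt_max => /and3P[Mz Tz T2z].
have [lo] := HM z Mz; set la := ln (normc (lead_coef f)) => as1.
have m0 : T <= m c z 0 by rewrite /= hornerX ltW.
have m1 : T <= m c z 1.
  apply: le_trans lo; move: T2z; rewrite ltr_pdivrMr // => ?; lra.
have esc : escapes f c z 0 by split; [apply: le_trans m0|apply: le_trans m1].
have mT n : T <= m c z n.
  by have := escapes_mono esc m0 m1 n; rewrite addn0.
have Wn0 n : W c z n != 0 by rewrite -normc_gt0; apply: lt_le_trans (mT n).
(* Both subtracted terms solve the Fibonacci recurrence exactly; their initial values remove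
   $\ln|z|$ at index 0 and $d_1\ln|z|$ plus [la] at index 1, so only small errors remain. *)
pose er n := ln (m c z n) - (d c n)%:R * ln (normc z) - (d c n)%:R * s c n * la.
have erSS n : `|er n.+2 - er n.+1 - er n| <= h.
  have -> : er n.+2 - er n.+1 - er n = ln (normc (1 + c / (W c z n.+1 * W c z n))).
    rewrite /er ln_normc_fseqSS // dseq_series_recurrence dseqSS // natrD.
    by ring.
  have qT : normc (c / (W c z n.+1 * W c z n)) <= normc c / T.
    rewrite normcM normcV normcM ler_wpM2l // lef_pV2 ?posrE ?mulr_gt0 ?normc_gt0 //.
    apply: le_trans (mT n) _; rewrite ler_peMl ?normc_ge0 //.
    by apply: le_trans (mT n.+1); lra.
  have q2 : normc c / T <= 1 / 2 by rewrite ler_pdivrMr //; lra.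
  apply: le_trans (ln_normc1D (le_trans qT q2)) _.
  apply: (@le_trans _ _ (2 * (normc c / T))); first by rewrite ler_wpM2l.
  rewrite mulrA ler_pdivrMr //; have : 2 * normc c / h <= T by rewrite /T; lra.
  by rewrite ler_pdivrMr // [T * h]mulrC.
have er0 : er 0%N = 0.
  by rewrite /er /= hornerX dseq0 /series /= big_geq // mulr0 mul0r mul1r !subrr.
have er1 : `|er 1%N| <= h.
  rewrite /er /series /= big_nat1 dseq0 dseq1 expr0 !mul1r mulfV ?mul1r //.
  by rewrite pnatr_eq0 -lt0n.
(* The [- 1] makes the induction close: the two bounds and a new error [h] add up to exactly
   $h(2d_{n+2}-1)$. Dividing by the degree leaves at most $2h<e$. *)
have erB n : `|er n| <= h * (2 * (d c n)%:R - 1).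
  elim/ltn_ind: n => -[|[|n]] ih.
  - by rewrite er0 normr0 mulr_ge0 ?(ltW h0) // dseq0; lra.
  - apply: le_trans er1 _; rewrite ler_peMr ?(ltW h0) //.
    have : 1 <= (d c 1)%:R :> R by rewrite ler1n.
    by move: (d c 1)%:R => x x1; lra.
  have -> : er n.+2 = (er n.+2 - er n.+1 - er n) + (er n.+1 + er n) by ring.
  apply: le_trans (ler_normD _ _) _.
  have := ih n.+1 (leqnn _); have := ih n (leqnSn _); have := erSS n.
  have := ler_normD (er n.+1) (er n).
  rewrite dseqSS // natrD !mulrBr !mulrDr !mulr1; lra.
have cvg_er : `|er n / (d c n)%:R| @[n --> \oo] -->
    `|green f c z - ln (normc z) - limn (s c) * la|.
  apply: cvg_norm.
  have E n : er n / (d c n)%:R = ln (m c z n) / (d c n)%:R - ln (normc z) - s c n * la.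
    by rewrite /er; field; rewrite gt_eqF // dseq_natr_gt0.
  under eq_fun do rewrite E.
  apply: cvgB; last by apply: cvgM; [exact: series_dseq_cvg|exact: cvg_cst].
  apply: cvgB; last exact: cvg_cst.
  have := green_escapes_cvg hf esc.
  by under eq_fun do rewrite addn0.
rewrite mulrC; apply: (@le_lt_trans _ _ (2 * h)); last by rewrite /h; lra.
apply: (cvgr_to_le cvg_er); apply: nearW => n.
rewrite normrM normfV normr_nat ler_pdivrMr ?dseq_natr_gt0 //.
apply: le_trans (erB n) _; rewrite mulrBr mulr1.
by rewrite mulrCA mulrA lerBlDr lerDl ltW.
Qed.

End asymptotics.

(** * Harmonicity *)

Section harmonic_criterion.
Variables (R : realType) (U : set R[i]) (u : R[i] -> R).
Variables (G1 G2 : R[i] -> R[i] -> R).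
Hypothesis openU : open U.
Hypothesis uG1 : forall v z, U z ->
  is_derive (0 : R) 1 (fun t : R => u (z + t%:C * v)) (G1 v z).
Hypothesis G1G2 : forall a v z, U z ->
  is_derive (0 : R) 1 (fun t : R => G1 a (z + t%:C * v)) (G2 (a * v) z).
Hypothesis G1_continuous : forall a z, U z -> {for z, continuous (G1 a)}.
Hypothesis G2_continuous : forall a z, U z -> {for z, continuous (G2 a)}.
Hypothesis G2N : forall z, U z -> G2 (-1) z = - G2 1 z.

Let pdxE (h : R[i] -> R) (l : R) z :
  is_derive (0 : R) 1 (fun t : R => h (z + t%:C * 1)) l ->
  derivable (fun t : R => h (z + t%:C)) 0 1 /\ pdx h z = l.
Proof.
under eq_fun do rewrite mulr1.
by move=> [dh e]; split => //; rewrite /pdx derive1E.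
Qed.

Let pdyE (h : R[i] -> R) (l : R) z :
  is_derive (0 : R) 1 (fun t : R => h (z + t%:C * 'i)) l ->
  derivable (fun t : R => h (z + t *i)) 0 1 /\ pdy h z = l.
Proof.
have E (t : R) : t%:C * 'i = t *i by simpc.
under eq_fun do rewrite E.
by move=> [dh e]; split => //; rewrite /pdy derive1E.
Qed.

Let near_U z : U z -> \forall w \near z, U w.
Proof. exact: openU. Qed.

Let near_line v z : U z -> \forall t \near (0 : R), U (z + t%:C * v).
Proof.
move=> /near_U/nbhs_normcP[r r0 H].
have v1 : 0 < normc v + 1 by rewrite ltr_wpDl // normc_ge0.
apply/nbhs_normP; exists (r / (normc v + 1)) => /= [|t]; first exact: divr_gt0.
rewrite /= sub0r normrN ltr_pdivlMr // => tr; apply: H.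
rewrite [z + _]addrC addrK normcM normc_real; apply: le_lt_trans tr.
by rewrite ler_wpM2l // lerDl.
Qed.

Let near_continuous (h k : R[i] -> R) z : (forall w, U w -> h w = k w) -> U z ->
  {for z, continuous h} -> {for z, continuous k}.
Proof.
move=> hk Uz ch; rewrite /prop_for /continuous_at -hk //.
apply: cvg_trans ch; apply: (@near_eq_cvg _ _ (nbhs z)).
by apply: filterS (near_U Uz) => w /hk.
Qed.

Let near_is_derive (h k : R[i] -> R) v z (l : R) : (forall w, U w -> h w = k w) ->
  U z -> is_derive (0 : R) 1 (fun t : R => h (z + t%:C * v)) l ->
  is_derive (0 : R) 1 (fun t : R => k (z + t%:C * v)) l.
Proof.
move=> hk Uz; apply: near_eq_is_derive.
by apply: filterS (near_line v Uz) => t /hk.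
Qed.

(** The functions [G1 a] and [G2 a] model $\mathrm{Re}(aG)$ and $\mathrm{Re}(aG')$ with $G$
    holomorphic: in [G1G2] only the product [a * v] enters, which encodes the Cauchy-Riemann
    equations. The Laplacian is then [G2 1] plus [G2 ('i * 'i)], that is [G2 1 + G2 (-1)]. *)
Lemma harmonic_criterion : harmonic_on U u.
Proof.
have xE z : U z -> G1 1 z = pdx u z by move=> /(uG1 1)/pdxE[].
have yE z : U z -> G1 'i z = pdy u z by move=> /(uG1 'i)/pdyE[].
have dx v z : U z -> is_derive (0 : R) 1 (fun t : R => pdx u (z + t%:C * v)) (G2 v z).
  move=> Uz; apply: (near_is_derive xE Uz).
  by have := G1G2 1 v Uz; rewrite mul1r.
have dy v z : U z -> is_derive (0 : R) 1 (fun t : R => pdy u (z + t%:C * v)) (G2 ('i * v) z).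
  by move=> Uz; apply: (near_is_derive yE Uz); exact: G1G2.
have xxE z : U z -> G2 1 z = pdx (pdx u) z by move=> /(dx 1)/pdxE[].
have xyE z : U z -> G2 'i z = pdy (pdx u) z by move=> /(dx 'i)/pdyE[].
have yxE z : U z -> G2 ('i * 1) z = pdx (pdy u) z by move=> /(dy 1)/pdxE[].
have yyE z : U z -> G2 ('i * 'i) z = pdy (pdy u) z by move=> /(dy 'i)/pdyE[].
split; first exact: openU; first split.
- split=> z Uz.
  + by have [] := pdxE (uG1 1 Uz).
  + by have [] := pdyE (uG1 'i Uz).
  + by apply: (near_continuous xE Uz); exact: G1_continuous.
  + by apply: (near_continuous yE Uz); exact: G1_continuous.
- split=> z Uz.
  + by have [] := pdxE (dx 1 z Uz).
  + by have [] := pdyE (dx 'i z Uz).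
  + by apply: (near_continuous xxE Uz); exact: G2_continuous.
  + by apply: (near_continuous xyE Uz); exact: G2_continuous.
- split=> z Uz.
  + by have [] := pdxE (dy 1 z Uz).
  + by have [] := pdyE (dy 'i z Uz).
  + by apply: (near_continuous yxE Uz); exact: G2_continuous.
  + by apply: (near_continuous yyE Uz); exact: G2_continuous.
- move=> z Uz; rewrite -xxE // -yyE // -expr2 sqr_i G2N //.
  by rewrite addrN.
Qed.

End harmonic_criterion.

(** * Locally uniform bounds on logarithmic derivatives, and harmonicity of the limit *)

Section green_harmonic.
Variables (R : realType) (f : {poly R[i]}) (c : R[i]).
Hypothesis hf : (1 <= (size f).-1)%N.
Implicit Types (z w v a : R[i]).

Local Notation P n := (fseq f c n).
Local Notation d n := (dseq f c n).

Lemma logd_near_bounded (p : {poly R[i]}) z : p.[z] != 0 -> exists B : R,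
  \forall w \near z,
    [/\ normc (logd1 p w) <= B, normc (logd2 p w) <= B & normc (logd3 p w) <= B].
Proof.
move=> p0.
have cp (q : {poly R[i]}) : q.[w] @[w --> z] --> q.[z] by exact: continuous_hornerc.
have cV : p.[w]^-1 @[w --> z] --> p.[z]^-1 by apply: (@cvgV _ _ (nbhs z)).
have cq (q : {poly R[i]}) : q.[w] / p.[w] @[w --> z] --> q.[z] / p.[z].
  by apply: (@cvgM _ _ (nbhs z)); [exact: cp|exact: cV].
have c1 : logd1 p w @[w --> z] --> logd1 p z by exact: cq.
have c11 : logd1 p w * logd1 p w @[w --> z] --> logd1 p z * logd1 p z.
  by apply: (@cvgM _ _ (nbhs z)); exact: c1.
have c2 : logd2 p w @[w --> z] --> logd2 p z.
  by apply: (@cvgB _ _ _ (nbhs z)); [exact: cq|exact: c11].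
have c3 : logd3 p w @[w --> z] --> logd3 p z.
  apply: (@cvgD _ _ _ (nbhs z)).
    apply: (@cvgB _ _ _ (nbhs z)); first exact: cq.
    apply: (@cvgM _ _ (nbhs z)); first exact: (@cvg_cst _ (3%:R : R[i]) _ (nbhs z)).
    by apply: (@cvgM _ _ (nbhs z)); [exact: cq|exact: c1].
  apply: (@cvgM _ _ (nbhs z)); first exact: (@cvg_cst _ (2%:R : R[i]) _ (nbhs z)).
  by apply: (@cvgM _ _ (nbhs z)); [exact: c11|exact: c1].
have bnd (h : R[i] -> R[i]) : h w @[w --> z] --> h z ->
    \forall w \near z, normc (h w) <= normc (h z) + 1.
  move=> ch; have cn : normc (h w) @[w --> z] --> normc (h z).
    by apply: (@cvg_comp _ _ _ h (@normc R) _ _ _ ch); exact: continuous_normc.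
  by apply: (@cvgr_le _ _ (nbhs z) _ _ _ cn); rewrite ltrDl.
pose B := (normc (logd1 p z) + 1) + (normc (logd2 p z) + 1) + (normc (logd3 p z) + 1).
exists B; apply: filterS3 (bnd _ c1) (bnd _ c2) (bnd _ c3) => w b1 b2 b3.
have := normc_ge0 (logd1 p z); have := normc_ge0 (logd2 p z).
have := normc_ge0 (logd3 p z) => *.
by split; [apply: le_trans b1 _|apply: le_trans b2 _|apply: le_trans b3 _];
  rewrite /B; lra.
Qed.

(** The margin 33 keeps the pair at [N] escaping on a whole disc, and continuity bounds the first
    two jets there. As $c/f_{n+2+N}$ decays like $16^{-n}$, [fib_jets] propagates these bounds with
    a constant independent of [w]. *)
Lemma notK_local_bounds z : (~` Kset f c) z -> exists N (r B : R), 0 < r /\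
  forall w, normc (w - z) < r -> escapes f c w N /\
    forall n, let p := P (n + N) in let D : R := (d (n + N))%:R in
    [/\ normc (logd1 p w) <= B * D, normc (logd2 p w) <= B * D,
        normc (logd3 p w) <= B * D,
        normc (logd1 (P (n.+2 + N)) w - logd1 (P (n.+1 + N)) w - logd1 p w) <= B
      & normc (logd2 (P (n.+2 + N)) w - logd2 (P (n.+1 + N)) w - logd2 p w) <= B].
Proof.
move=> /(notK_large (33 + 2 * normc c))[N [N0 N1]].
have c0 := normc_ge0 c.
have nz j : 33 + 2 * normc c <= normc (P j).[z] -> (P j).[z] != 0.
  by move=> h; rewrite -normc_gt0; apply: lt_le_trans h; lra.
have near_ge j : 33 + 2 * normc c <= normc (P j).[z] ->
    \forall w \near z, 32 + 2 * normc c <= normc (P j).[w].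
  move=> h; have cn : normc (P j).[w] @[w --> z] --> normc (P j).[z].
    apply: (@cvg_comp _ _ _ (horner (P j)) (@normc R)); first exact: continuous_hornerc.
    exact: continuous_normc.
  by apply: (@cvgr_ge _ _ (nbhs z) _ _ _ cn); lra.
have [B1 n1] := logd_near_bounded (nz _ N0).
have [B2 n2] := logd_near_bounded (nz _ N1).
have [r r0 Hr] : exists2 r : R, 0 < r & forall w, normc (w - z) < r ->
    escapes f c w N /\ forall j, (j < 2)%N ->
      [/\ normc (logd1 (P (j + N)) w) <= Num.max B1 B2,
          normc (logd2 (P (j + N)) w) <= Num.max B1 B2
        & normc (logd3 (P (j + N)) w) <= Num.max B1 B2].
  have /nbhs_normcP[r1 r10 g1] := near_ge _ N0.
  have /nbhs_normcP[r2 r20 g2] := near_ge _ N1.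
  have /nbhs_normcP[r3 r30 g3] := n1.
  have /nbhs_normcP[r4 r40 g4] := n2.
  exists (Num.min (Num.min r1 r2) (Num.min r3 r4)).
    by rewrite !lt_min r10 r20 r30 r40.
  move=> w; rewrite !lt_min => /andP[/andP[w1 w2] /andP[w3 w4]].
  split; first by split; [exact: g1|exact: g2].
  have [b1 b2 b3] := g3 w w3; have [b1' b2' b3'] := g4 w w4.
  by move=> [|[|]] // _; rewrite !le_max ?b1 ?b2 ?b3 ?b1' ?b2' ?b3' ?orbT.
have [B HB] := @fib_jets R (fun n => d (n + N)) (dseq_gt0 hf c _) (dseq_le hf c _)
  (fun n => dseqSS hf c (n + N)) (Num.max B1 B2) _ c0.
exists N, r, B; split => // w /Hr[esc init]; split=> // n.
have Pn0 j : (P (j + N)).[w] != 0 by rewrite -normc_gt0; exact: (escapes_gt0 esc).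
have rec j := logd_recurrence (Pn0 j.+1) (Pn0 j) (Pn0 j.+2).
apply: (HB (fun n => logd1 (P (n + N)) w) (fun n => logd2 (P (n + N)) w)
  (fun n => logd3 (P (n + N)) w) (fun n => c / (P (n.+2 + N)).[w])) => // j.
- rewrite normcM normcV ler_wpM2l // lef_pV2 ?posrE ?normc_gt0 ?exprn_gt0 //.
  apply: le_trans (escapes_growth esc j.+2).
  by apply: ler_weXn2l; rewrite ?ler1n // leqW.
- by case: (rec j).
- by case: (rec j).
- by case: (rec j).
Qed.

(** This is $\mathrm{Re}(aG(z))$ with $G=\lim f_n'/(d_nf_n)$, the derivative of $g_c$ in the
    direction [a] off [Kset f c]. The multiplier sits inside so that only real limits occur;
    [green2] is $\mathrm{Re}(aG'(z))$ likewise. *)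
Definition green1 a z : R := limn (fun n => Re (a * logd1 (P n) z) / (d n)%:R).
Definition green2 a z : R := limn (fun n => Re (a * logd2 (P n) z) / (d n)%:R).

Lemma limn_shift (x : nat -> R) N : cvgn (fun n => x (n + N)%N) ->
  x (n + N)%N @[n --> \oo] --> limn x.
Proof.
move=> cx; have cv : x n @[n --> \oo] --> limn (fun n => x (n + N)%N).
  by rewrite -(cvg_shiftn N).
by rewrite (cvg_lim _ cv).
Qed.

Lemma is_derive_Re_div (F : R -> R[i]) (t D : R) a v : cderive F t v ->
  is_derive t 1 (fun s => Re (a * F s) / D) (Re (a * v) / D).
Proof.
move=> dF; have [d1 _] := cderive_mul (cderive_cst a t) dF.
have := is_derive_mul d1 (is_derive_cst (D^-1 : R) t 1).
by rewrite mulr0 add0r mul0r add0r mulrC.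
Qed.

Lemma Re_div_le a x (D B k : R) : 0 < D -> normc a <= k ->
  normc x <= B * D -> `|Re (a * x) / D| <= k * B.
Proof.
move=> D0 ak xB; rewrite normrM normfV (ger0_norm (ltW D0)) ler_pdivrMr //.
apply: le_trans (normr_Re_le _) _.
by rewrite normcM -mulrA ler_pM ?normc_ge0.
Qed.

Lemma normr_lim_sub_le (x y : nat -> R) (l k C : R) :
  x n @[n --> \oo] --> l -> y n @[n --> \oo] --> k ->
  (forall n, `|x n - y n| <= C) -> `|l - k| <= C.
Proof.
move=> xl yk xyC; have cv : `|x n - y n| @[n --> \oo] --> `|l - k|.
  by apply: cvg_norm; exact: cvgB.
by apply: (cvgr_to_le cv); apply: nearW.
Qed.

(** * Derivatives and continuity of the limits at the centre of a disc *)

Section near_point.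
Variables (z : R[i]) (N : nat) (r B : R).
Hypothesis r0 : 0 < r.
Hypothesis HB : forall w, normc (w - z) < r -> escapes f c w N /\
  forall n, let p := P (n + N) in let D : R := (d (n + N))%:R in
  [/\ normc (logd1 p w) <= B * D, normc (logd2 p w) <= B * D,
      normc (logd3 p w) <= B * D,
      normc (logd1 (P (n.+2 + N)) w - logd1 (P (n.+1 + N)) w - logd1 p w) <= B
    & normc (logd2 (P (n.+2 + N)) w - logd2 (P (n.+1 + N)) w - logd2 p w) <= B].

Let D0 n : 0 < (d (n + N))%:R :> R := dseq_natr_gt0 hf c (n + N).

Lemma green1_cvg a w : normc (w - z) < r ->
  Re (a * logd1 (P (n + N)) w) / (d (n + N))%:R @[n --> \oo] --> green1 a w.
Proof.
move=> /HB[_ h]; apply: (limn_shift (x := fun n => Re (a * logd1 (P n) w) / (d n)%:R)).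
apply: (@fib_ratio_cvg_Re R (fun n => d (n + N)) (dseq_gt0 hf c _)
  (dseq_le hf c _) (fun n => dseqSS hf c (n + N)) (fun n => logd1 (P (n + N)) w) a B).
by move=> n; case: (h n).
Qed.

Lemma green2_cvg a w : normc (w - z) < r ->
  Re (a * logd2 (P (n + N)) w) / (d (n + N))%:R @[n --> \oo] --> green2 a w.
Proof.
move=> /HB[_ h]; apply: (limn_shift (x := fun n => Re (a * logd2 (P n) w) / (d n)%:R)).
apply: (@fib_ratio_cvg_Re R (fun n => d (n + N)) (dseq_gt0 hf c _)
  (dseq_le hf c _) (fun n => dseqSS hf c (n + N)) (fun n => logd2 (P (n + N)) w) a B).
by move=> n; case: (h n).
Qed.

Lemma fseq_neq0_near w n : normc (w - z) < r -> (P (n + N)).[w] != 0.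
Proof. by move=> /HB[esc _]; rewrite -normc_gt0; exact: (escapes_gt0 esc). Qed.

Section line.
Variables (v : R[i]) (rho : R).
Hypothesis rho0 : 0 < rho.
Hypothesis rhov : forall t : R, `|t| < rho -> normc (t%:C * v) < r.

Let in_ball (t : R) : `|t| < rho -> normc (z + t%:C * v - z) < r.
Proof. by move=> /rhov; rewrite [z + _]addrC addrK. Qed.

Let d_ln n (t : R) : `|t| < rho ->
  is_derive t 1 (fun s : R => ln (normc (P (n + N)).[z + s%:C * v]) / (d (n + N))%:R)
    (Re (v * logd1 (P (n + N)) (z + t%:C * v)) / (d (n + N))%:R).
Proof.
move=> /in_ball/(@fseq_neq0_near _ n) p0.
have dl := is_derive_ln_normc p0 (cderive_horner (P (n + N)) (cderive_line z v t)).
have := is_derive_mul dl (is_derive_cst ((d (n + N))%:R^-1 : R) t 1).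
by rewrite mulr0 add0r [_^-1 * _]mulrC -mulrA.
Qed.

Let d_logd1 a n (t : R) : `|t| < rho ->
  is_derive t 1 (fun s : R => Re (a * logd1 (P (n + N)) (z + s%:C * v)) / (d (n + N))%:R)
    (Re (a * v * logd2 (P (n + N)) (z + t%:C * v)) / (d (n + N))%:R).
Proof.
move=> /in_ball/(@fseq_neq0_near _ n) p0; rewrite -mulrA.
exact: is_derive_Re_div (cderive_logd1 p0).
Qed.

Let d_logd2 a n (t : R) : `|t| < rho ->
  is_derive t 1 (fun s : R => Re (a * logd2 (P (n + N)) (z + s%:C * v)) / (d (n + N))%:R)
    (Re (a * v * logd3 (P (n + N)) (z + t%:C * v)) / (d (n + N))%:R).
Proof.
move=> /in_ball/(@fseq_neq0_near _ n) p0; rewrite -mulrA.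
exact: is_derive_Re_div (cderive_logd2 p0).
Qed.

Let line0 : z + (0 : R)%:C * v = z.
Proof. by rewrite mul0r addr0. Qed.

Let zz : normc (z - z) < r.
Proof. by rewrite subrr normc0. Qed.

(** [is_derive_limit] applies to $\ln|f_n|/d_n$ along the line: its second derivative
    $\mathrm{Re}(v^2(f_n'/f_n)')/d_n$ is at most $|v^2|B$, uniformly in $n$. *)
Lemma is_derive_green :
  is_derive (0 : R) 1 (fun t : R => green f c (z + t%:C * v)) (green1 v z).
Proof.
apply: (is_derive_limit (M := normc (v * v) * B) rho0 d_ln (@d_logd1 v)) => [n t tr|t tr|].
- have [_ /(_ n)[_ b2 _ _ _]] := HB (in_ball tr).
  exact: Re_div_le (D0 n) (lexx _) b2.
- have [esc _] := HB (in_ball tr); exact: (green_escapes_cvg hf esc).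
- by rewrite line0; exact: green1_cvg.
Qed.

Lemma is_derive_green1 a :
  is_derive (0 : R) 1 (fun t : R => green1 a (z + t%:C * v)) (green2 (a * v) z).
Proof.
apply: (is_derive_limit (M := normc (a * v * v) * B) rho0 (@d_logd1 a)
  (@d_logd2 (a * v))) => [n t tr|t tr|].
- have [_ /(_ n)[_ _ b3 _ _]] := HB (in_ball tr).
  exact: Re_div_le (D0 n) (lexx _) b3.
- exact: green1_cvg (in_ball tr).
- by rewrite line0; exact: green2_cvg.
Qed.

(** Each approximant satisfies the mean value bound with the same constant, which therefore survives
    the limit. The condition on [rho] puts the parameter 1, that is the point [z + v], inside the
    range. *)
Lemma green1_lipschitz_line a : 1 < rho ->
  `|green1 a (z + v) - green1 a z| <= normc (a * v) * B.
Proof.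
move=> rho1; have t1 : `|1 : R| < rho by rewrite normr1.
have t0 : `|0 : R| < rho by rewrite normr0.
have z1 := in_ball t1; rewrite mul1r in z1.
apply: (normr_lim_sub_le (@green1_cvg a _ z1) (@green1_cvg a _ zz)) => n.
have [s sr e] := MVT_ball (@d_logd1 a n) t0 t1.
rewrite line0 mul1r subr0 mulr1 in e; rewrite e.
have sr' : `|s| < rho.
  by apply: le_lt_trans sr _; rewrite gt_max t0 t1.
have [_ /(_ n)[_ b2 _ _ _]] := HB (in_ball sr').
exact: Re_div_le (D0 n) (lexx _) b2.
Qed.

Lemma green2_lipschitz_line a : 1 < rho ->
  `|green2 a (z + v) - green2 a z| <= normc (a * v) * B.
Proof.
move=> rho1; have t1 : `|1 : R| < rho by rewrite normr1.
have t0 : `|0 : R| < rho by rewrite normr0.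
have z1 := in_ball t1; rewrite mul1r in z1.
apply: (normr_lim_sub_le (@green2_cvg a _ z1) (@green2_cvg a _ zz)) => n.
have [s sr e] := MVT_ball (@d_logd2 a n) t0 t1.
rewrite line0 mul1r subr0 mulr1 in e; rewrite e.
have sr' : `|s| < rho.
  by apply: le_lt_trans sr _; rewrite gt_max t0 t1.
have [_ /(_ n)[_ _ b3 _ _]] := HB (in_ball sr').
exact: Re_div_le (D0 n) (lexx _) b3.
Qed.

End line.

Lemma continuous_of_lipschitz_lines (h : R[i] -> R) (k : R) :
  (forall v rho, 0 < rho -> (forall t : R, `|t| < rho -> normc (t%:C * v) < r) ->
     1 < rho -> `|h (z + v) - h z| <= k * normc v) ->
  {for z, continuous h}.
Proof.
move=> hk; apply/(@cvgrPdist_lt _ _ _ (nbhs z)) => e e0; apply/nbhs_normcP.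
have k1 : 0 < `|k| + 1 by rewrite ltr_wpDl.
exists (Num.min r (e / (`|k| + 1))); first by rewrite lt_min r0 divr_gt0.
move=> w; rewrite lt_min => /andP[wr we].
have [->|wz] := eqVneq w z; first by rewrite subrr normr0.
have nv : 0 < normc (w - z) by rewrite normc_gt0 subr_eq0.
(* This [rho] is the largest for which the line stays in the disc, and it exceeds 1 because [w] lies
   in the disc; the case [w = z] was set apart to allow the division. *)
have := hk (w - z) (r / normc (w - z)).
rewrite [z + _]addrC subrK distrC => H.
apply: le_lt_trans (H _ _ _) _.
- exact: divr_gt0.
- by move=> t; rewrite normcM normc_real ltr_pdivlMr.
- by rewrite ltr_pdivlMr // mul1r.
rewrite ltr_pdivlMr // mulrC in we; apply: le_lt_trans we.
by rewrite ler_wpM2r ?(ltW nv) // (le_trans (ler_norm k)) // lerDl.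
Qed.

Lemma green1_continuous a : {for z, continuous (green1 a)}.
Proof.
apply: (@continuous_of_lipschitz_lines _ (normc a * B)) => v rho h1 h2 h3.
by rewrite mulrAC -normcM; exact: green1_lipschitz_line h1 h2 a h3.
Qed.

Lemma green2_continuous a : {for z, continuous (green2 a)}.
Proof.
apply: (@continuous_of_lipschitz_lines _ (normc a * B)) => v rho h1 h2 h3.
by rewrite mulrAC -normcM; exact: green2_lipschitz_line h1 h2 a h3.
Qed.

Lemma green2N : green2 (-1) z = - green2 1 z.
Proof.
have zr : normc (z - z) < r by rewrite subrr normc0.
have cN := @green2_cvg (-1) z zr.
have c1 : - (Re (1 * logd2 (P (n + N)) z) / (d (n + N))%:R) @[n --> \oo] -->
    - green2 1 z by apply: cvgN; exact: green2_cvg.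
have E n : Re (-1 * logd2 (P (n + N)) z) / (d (n + N))%:R =
    - (Re (1 * logd2 (P (n + N)) z) / (d (n + N))%:R).
  by rewrite mulN1r mul1r -mulNr; congr (_ / _); case: (logd2 _ _).
rewrite (funext E) in cN.
by rewrite -(cvg_lim _ cN) // -(cvg_lim _ c1).
Qed.

Lemma line_radius v : exists2 rho : R, 0 < rho &
  forall t : R, `|t| < rho -> normc (t%:C * v) < r.
Proof.
have v1 : 0 < normc v + 1 by rewrite ltr_wpDl // normc_ge0.
exists (r / (normc v + 1)) => [|t]; first exact: divr_gt0.
rewrite ltr_pdivlMr // normcM normc_real; apply: le_lt_trans.
by rewrite ler_wpM2l // lerDl.
Qed.

End near_point.

Lemma green_harmonic : harmonic_on (~` Kset f c) (green f c).
Proof.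
apply: (@harmonic_criterion R _ _ green1 green2).
- rewrite openE => z /notK_local_bounds[N [r [B [r0 HB]]]].
  apply/nbhs_normcP; exists r => // w /HB[esc _]; exact: escapes_notK esc.
- move=> v z /notK_local_bounds[N [r [B [r0 HB]]]].
  have [rho h0 hv] := line_radius r0 v; exact (is_derive_green r0 HB h0 hv).
- move=> a v z /notK_local_bounds[N [r [B [r0 HB]]]].
  have [rho h0 hv] := line_radius r0 v; exact (is_derive_green1 r0 HB h0 hv a).
- by move=> a z /notK_local_bounds[N [r [B [r0 HB]]]]; exact: green1_continuous r0 HB a.
- by move=> a z /notK_local_bounds[N [r [B [r0 HB]]]]; exact: green2_continuous r0 HB a.
- by move=> z /notK_local_bounds[N [r [B [r0 HB]]]]; exact: green2N r0 HB.
Qed.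

End green_harmonic.

Theorem theorem3p5 (R : realType) (f : {poly R[i]}) (hf : (1 <= (size f).-1)%N) :
  (forall c : R[i],
     [/\ (* the limit defining g_c exists, and g_c takes values in R_+ *)
         forall z : R[i], cvgn (green_seq f c z) /\ 0 <= green f c z,
         (* (1) *)
         harmonic_on (~` Kset f c) (green f c),
         (* (2) *)
         Kset f c = green f c @^-1` [set 0] &
         (* (3) *)
         let s := series (fun n : nat =>
           (-1) ^+ n / ((dseq f c n)%:R * (dseq f c n.+1)%:R) : R) in
         cvgn s /\
         forall e : R, 0 < e -> exists M : R, forall z : R[i], M < normc z ->
           `|green f c z - ln (normc z) - ln (normc (lead_coef f)) * limn s|
             < e]) /\
  (* (4) *)
  continuous (fun p : R[i] * R[i] => green f p.1 p.2).
Proof.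
split=> [c|]; last exact: green_continuous.
split.
- by move=> z; split; [exact: green_seq_cvg|exact: green_ge0].
- exact: green_harmonic.
- exact: Kset_green.
- by split; [exact: series_dseq_cvg|exact: green_near_infty].
Qed.
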